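(* Let $R$ be a commutative Noetherian ring and let $M$ be a finitely generated $R$-module such that $\operatorname{G-dim}_R(\operatorname{Hom}_R(M,R))<\infty$ and $\operatorname{pd}_R(\operatorname{Hom}_R(M,M))<\infty$. Then the Auslander-Reiten conjecture holds for $M$; that is, if $\operatorname{Ext}_R^i(M,R)=\operatorname{Ext}_R^i(M,M)=0$ for all $i>0$, then $M$ is projective.
   Context: Write $N^\ast=\operatorname{Hom}_R(N,R)$. A finitely generated module $G$ is totally reflexive if it is reflexive and $\operatorname{Ext}_R^i(G,R)=\operatorname{Ext}_R^i(G^\ast,R)=0$ for all $i>0$. $\operatorname{G-dim}_R(N)$ is the infimum of the non-negative integers $m$ for which there is an exact sequence $0\to G_m\to\cdots\to G_0\to N\to 0$ with every $G_i$ totally reflexive. *)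

(* Defs.v *)
From HB Require Import structures.
From mathcomp Require Import all_boot all_order all_algebra.
From mathcomp Require Import all_classical.
From mathcomp Require Import constructive_ereal.

Set Implicit Arguments.
Unset Strict Implicit.
Unset Printing Implicit Defensive.

Import Order.TTheory GRing.Theory Num.Theory.
Local Open Scope classical_set_scope.
Local Open Scope ring_scope.

(* Rings are comPzRingType: the zero ring is allowed. *)

Section ModuleNotions.
Context {R : comPzRingType}.
Implicit Types U V W : lmodType R.

Definition zero_module V : Prop := forall x : V, x = 0.

Definition surjective U V (f : U -> V) : Prop := forall y, exists x, f x = y.

Definition spanned V n (g : 'I_n -> V) (x : V) : Prop :=
  exists c : 'I_n -> R, x = \sum_i c i *: g i.

Definition finitely_generated V : Prop :=
  exists n (g : 'I_n -> V), forall x, spanned g x.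

Definition projective_module V : Prop :=
  forall (A B : lmodType R) (p : {linear A -> B}) (f : {linear V -> B}),
    surjective p -> exists h : {linear V -> A}, forall x, p (h x) = f x.

End ModuleNotions.

(* Ideals are the R-submodules of the regular module R^o. *)
Definition noetherian (R : comPzRingType) : Prop :=
  forall I : {pred R^o}, submod_closed I ->
    exists n (g : 'I_n -> R^o), forall x, x \in I <-> spanned g x.

Section HomModule.
Context {R : comPzRingType}.

Definition Hom_module (U V : lmodType R) := {linear U -> V}.

Section Instances.
Variables U V : lmodType R.

Lemma Hom_ext (f g : Hom_module U V) : (forall x, f x = g x) -> f = g.
Proof.
case: f g => [f cf] [g cg] /= fg.
have {}fg : f = g by apply/funext.
case: _ / fg in cg *.
case: cf cg => [[a1] [b1]] [[a2] [b2]].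
by rewrite (Prop_irrelevance a1 a2) (Prop_irrelevance b1 b2).
Qed.

HB.instance Definition _ := gen_eqMixin (Hom_module U V).
HB.instance Definition _ := gen_choiceMixin (Hom_module U V).

Definition Hom_zero : Hom_module U V := \0.
Definition Hom_opp (f : Hom_module U V) : Hom_module U V := \- f.
Definition Hom_add (f g : Hom_module U V) : Hom_module U V := f \+ g.
Definition Hom_scale (a : R) (f : Hom_module U V) : Hom_module U V := a \*: f.

Fact Hom_addA : associative Hom_add.
Proof. by move=> f g h; apply: Hom_ext => x /=; rewrite addrA. Qed.
Fact Hom_addC : commutative Hom_add.
Proof. by move=> f g; apply: Hom_ext => x /=; rewrite addrC. Qed.
Fact Hom_add0 : left_id Hom_zero Hom_add.
Proof. by move=> f; apply: Hom_ext => x /=; rewrite add0r. Qed.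
Fact Hom_addN : left_inverse Hom_zero Hom_opp Hom_add.
Proof. by move=> f; apply: Hom_ext => x /=; rewrite addNr. Qed.
HB.instance Definition _ :=
  GRing.isZmodule.Build (Hom_module U V) Hom_addA Hom_addC Hom_add0 Hom_addN.

Fact Hom_scaleA a b (f : Hom_module U V) :
  Hom_scale a (Hom_scale b f) = Hom_scale (a * b) f.
Proof. by apply: Hom_ext => x /=; rewrite scalerA. Qed.
Fact Hom_scale1 : left_id 1 Hom_scale.
Proof. by move=> f; apply: Hom_ext => x /=; rewrite scale1r. Qed.
Fact Hom_scaleDr : right_distributive Hom_scale +%R.
Proof. by move=> a f g; apply: Hom_ext => x /=; rewrite scalerDr. Qed.
Fact Hom_scaleDl (f : Hom_module U V) : {morph Hom_scale^~ f : a b / a + b}.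
Proof. by move=> a b; apply: Hom_ext => x /=; rewrite scalerDl. Qed.
HB.instance Definition _ := GRing.Zmodule_isLmodule.Build R (Hom_module U V)
  Hom_scaleA Hom_scale1 Hom_scaleDr Hom_scaleDl.
End Instances.

Definition dual_module (U : lmodType R) : lmodType R := Hom_module U R^o.

Section Precomposition.
Variables (U V N : lmodType R) (f : {linear U -> V}).
Definition precomp_fun (g : Hom_module V N) : Hom_module U N := g \o f.
Fact precomp_is_linear : linear precomp_fun.
Proof. by move=> a g h; apply: Hom_ext. Qed.
HB.instance Definition _ :=
  GRing.isLinear.Build R (Hom_module V N) (Hom_module U N) *:%R
    precomp_fun precomp_is_linear.
Definition precomp : {linear Hom_module V N -> Hom_module U N} := precomp_fun.
End Precomposition.

Section Biduality.
Variable U : lmodType R.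

Definition ev_at (x : U) (f : dual_module U) : R^o := (f : Hom_module U R^o) x.
Fact ev_at_is_linear x : linear (ev_at x).
Proof. by []. Qed.
HB.instance Definition _ x :=
  GRing.isLinear.Build R (dual_module U) R^o *:%R (ev_at x) (ev_at_is_linear x).

Definition biduality (x : U) : dual_module (dual_module U) :=
  (ev_at x : {linear _ -> _}).
Fact biduality_is_linear : linear biduality.
Proof. by move=> a x y; apply: Hom_ext => f; rewrite /= /ev_at linearP. Qed.
HB.instance Definition _ :=
  GRing.isLinear.Build R U (dual_module (dual_module U)) *:%R
    biduality biduality_is_linear.

Definition reflexive_module : Prop := bijective biduality.
End Biduality.

End HomModule.
Arguments precomp {R U V} N f.

Section KernelModule.
Context {R : comPzRingType} {U V : lmodType R} (f : {linear U -> V}).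

Definition in_kernel : {pred U} := fun x => f x == 0.
Fact in_ker_submod : submod_closed in_kernel.
Proof.
split=> [|a x y]; rewrite !unfold_in ?linear0// => /eqP fx /eqP fy.
by rewrite linearP fx fy scaler0 addr0.
Qed.
HB.instance Definition _ :=
  GRing.isSubmodClosed.Build R U in_kernel in_ker_submod.

Record ker_module := KernelElt {
  kernel_val : U;
  kernel_valP : kernel_val \in in_kernel;
}.
HB.instance Definition _ := [isSub for kernel_val].
HB.instance Definition _ := [Choice of ker_module by <:].
HB.instance Definition _ := [SubChoice_isSubLmodule of ker_module by <:].

Fact ker_val_is_linear : linear kernel_val.
Proof. exact: (linearP (\val : ker_module -> U)). Qed.
HB.instance Definition _ :=
  GRing.isLinear.Build R ker_module U *:%R kernel_val ker_val_is_linear.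
End KernelModule.

Section QuotientModule.
Context {R : comPzRingType} {V : lmodType R}.
Context {S : {pred V}} (Smod : submod_closed S).

Definition quot_pred of submod_closed S : {pred V} := S.
HB.instance Definition _ :=
  GRing.isSubmodClosed.Build R V (quot_pred Smod) Smod.

Definition quot_zmod : zmodClosed V := quot_pred Smod.

Definition quotient_module := Quotient.quot quot_zmod.
HB.instance Definition _ := GRing.Zmodule.on quotient_module.
HB.instance Definition _ := Quotient.on quotient_module.

Local Notation pi := (\pi_quotient_module%qT).

Fact quotient_eqP (x y : V) : reflect (pi x = pi y) (x - y \in S).
Proof.
have := Quotient.idealrBE quot_zmod x y.
rewrite [LHS](_ : _ = (x - y \in S))// => ->.
exact: eqP.
Qed.

Definition quot_scale (a : R) (x : quotient_module) : quotient_module :=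
  pi (a *: repr x).

Fact quot_scale_pi a x : quot_scale a (pi x) = pi (a *: x).
Proof.
apply/quotient_eqP; rewrite -scalerBr.
have [S0 SZ] := Smod.
rewrite -[_ *: _]addr0 SZ//; apply/quotient_eqP.
by rewrite reprK.
Qed.

Fact quot_scaleA a b (x : quotient_module) :
  quot_scale a (quot_scale b x) = quot_scale (a * b) x.
Proof.
by elim/quotW: x => x; rewrite (quot_scale_pi b) !quot_scale_pi scalerA.
Qed.
Fact quot_scale1 : left_id 1 quot_scale.
Proof. by elim/quotW=> x; rewrite quot_scale_pi scale1r. Qed.
Fact quot_scaleDr : right_distributive quot_scale +%R.
Proof.
move=> a; elim/quotW=> x; elim/quotW=> y.
by rewrite -[pi x + pi y]raddfD !quot_scale_pi scalerDr raddfD.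
Qed.
Fact quot_scaleDl (x : quotient_module) : {morph quot_scale^~ x : a b / a + b}.
Proof.
by move=> a b; elim/quotW: x => x; rewrite !quot_scale_pi scalerDl raddfD.
Qed.
HB.instance Definition _ := GRing.Zmodule_isLmodule.Build R quotient_module
  quot_scaleA quot_scale1 quot_scaleDr quot_scaleDl.
End QuotientModule.

Section Cohomology.
Context {R : comPzRingType}.

Record chain_complex := ChainComplex {
  cplx_term :> nat -> lmodType R;
  cplx_diff : forall n, {linear cplx_term n.+1 -> cplx_term n};
  cplx_diffK : forall n x, cplx_diff n (cplx_diff n.+1 x) = 0;
}.

Variables (P : chain_complex) (N : lmodType R).

Definition cocycle n : lmodType R := ker_module (precomp N (cplx_diff P n)).

Definition coboundary n : {pred cocycle n} :=
  match n with
  | 0 => fun z : cocycle 0 => kernel_val z == 0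
  | m.+1 => fun z : cocycle m.+1 =>
      `[< exists g : Hom_module (P m) N,
            precomp N (cplx_diff P m) g = kernel_val z >]
  end.

Fact coboundary_submod n : submod_closed (@coboundary n).
Proof.
case: n => [|n]; split => [|a x y].
- by rewrite unfold_in linear0.
- rewrite !unfold_in => /eqP x0 /eqP y0.
  by rewrite linearPZ /= x0 y0 scaler0 addr0.
- by apply/asboolP; exists 0; rewrite !linear0.
- move=> /asboolP[f fx] /asboolP[g gy]; apply/asboolP.
  by exists (a *: f + g); rewrite !linearPZ /= fx gy.
Qed.

(* H^n(Hom(P, N)); no differential enters degree 0. *)
Definition cohomology n : lmodType R := quotient_module (@coboundary_submod n).

End Cohomology.

Section FreeModule.
Context {R : comPzRingType}.

Section Free.
Variable T : choiceType.

Definition supp (f : T -> R^o) : set T := [set x | f x != 0].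

Definition fin_support : {pred T -> R^o} := fun f => `[< finite_set (supp f) >].

Fact support_lin a (f g : T -> R^o) :
  supp (a *: f + g) `<=` supp f `|` supp g.
Proof.
move=> x /= fgx; have [f0|] := eqVneq (f x) 0; last by left.
right; apply: contra_neq fgx => g0.
by rewrite -[LHS]/(a *: f x + g x) f0 g0 scaler0 addr0.
Qed.

Fact fin_support_submod : submod_closed fin_support.
Proof.
split=> [|a f g].
  apply/asboolP; rewrite (_ : supp 0 = set0)//.
  by rewrite -subset0 => x /negP; apply; apply/eqP.
move=> /asboolP Hf /asboolP Hg; apply/asboolP.
by apply: sub_finite_set (@support_lin a f g) _; rewrite finite_setU.
Qed.
HB.instance Definition _ :=
  GRing.isSubmodClosed.Build R (T -> R^o) fin_support fin_support_submod.

(* The free module on T, as finitely supported functions T -> R. *)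
Record free_module := FreeElt {
  free_val : T -> R^o;
  free_valP : free_val \in fin_support;
}.
HB.instance Definition _ := [isSub for free_val].
HB.instance Definition _ := [Choice of free_module by <:].
HB.instance Definition _ := [SubChoice_isSubLmodule of free_module by <:].

Fact free_val_is_linear : linear free_val.
Proof. exact: (linearP (\val : free_module -> T -> R^o)). Qed.
HB.instance Definition _ :=
  GRing.isLinear.Build R free_module (T -> R^o) *:%R
    free_val free_val_is_linear.

Fact free_finite (f : free_module) : finite_set (supp (free_val f)).
Proof. exact/asboolP/free_valP. Qed.

Fact delta_fin_support (t : T) :
  (fun x => if x == t then 1 else 0 : R^o) \in fin_support.
Proof.
apply/asboolP; apply: (@sub_finite_set _ _ [set t]) => // x /=.
by apply: contraNP => /eqP/negPf xt; rewrite xt eqxx.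
Qed.
Definition free_basis (t : T) : free_module := FreeElt (delta_fin_support t).
End Free.

Section Counit.
Variable M : lmodType R.

Definition counit_fun (f : free_module M) : M :=
  \sum_(x \in supp (free_val f)) free_val f x *: x.

Fact counit_funE (f : free_module M) (A : set M) : finite_set A ->
  supp (free_val f) `<=` A -> counit_fun f = \sum_(x \in A) free_val f x *: x.
Proof.
move=> Afin fA; rewrite /counit_fun; apply: fsbig_widen => // x [_ /= ].
by move=> /negP; rewrite negbK => /eqP ->; rewrite scale0r.
Qed.

Fact counit_is_linear : linear counit_fun.
Proof.
move=> a f g.
pose A := supp (free_val f) `|` supp (free_val g).
have Afin : finite_set A by rewrite finite_setU; split; exact: free_finite.
have /(counit_funE Afin) Ef : supp (free_val f) `<=` A by move=> x; left.
have /(counit_funE Afin) Eg : supp (free_val g) `<=` A by move=> x; right.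
have /(counit_funE Afin) Efg : supp (free_val (a *: f + g)) `<=` A.
  by rewrite linearPZ; exact: support_lin.
rewrite Ef Eg Efg !fsbig_finite//= scaler_sumr -big_split/=.
by apply: eq_bigr => x _; rewrite scalerA -scalerDl.
Qed.
HB.instance Definition _ :=
  GRing.isLinear.Build R (free_module M) M *:%R counit_fun counit_is_linear.

Definition counit : {linear free_module M -> M} := counit_fun.

Fact counit_basis (x : M) : counit (free_basis x) = x.
Proof.
rewrite /= (@counit_funE _ [set x])//.
  by rewrite fsbig_set1 /= eqxx scale1r.
by move=> y /=; apply: contraNP => /eqP/negPf yx; rewrite /= yx eqxx.
Qed.
End Counit.

End FreeModule.

Section Resolutions.
Context {R : comPzRingType}.

Record resolution (M : lmodType R) := Resolution {
  res_complex :> chain_complex;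
  res_aug : {linear res_complex 0 -> M};
  res_aug_surj : surjective res_aug;
  res_exact0 : forall x,
    res_aug x = 0 <-> exists y, cplx_diff res_complex 0 y = x;
  res_exactS : forall n x,
    cplx_diff res_complex n x = 0 <->
      exists y, cplx_diff res_complex n.+1 y = x;
}.

Fixpoint syzygy (M : lmodType R) (n : nat) : lmodType R :=
  if n is m.+1 then ker_module (counit (syzygy M m)) else M.

Definition free_diff (M : lmodType R) n :
  {linear free_module (syzygy M n.+1) -> free_module (syzygy M n)} :=
  @kernel_val R _ _ (counit (syzygy M n)) \o counit (syzygy M n.+1).

Fact free_exact (M : lmodType R) n x :
  counit (syzygy M n) x = 0 <-> exists y, free_diff M n y = x.
Proof.
split=> [/eqP x0|[y <-]]; last by apply/eqP; exact: kernel_valP (counit_fun y).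
exists (free_basis (KernelElt x0 : syzygy M n.+1)).
by rewrite /free_diff /=; rewrite -[counit_fun _]/(counit _ _) counit_basis.
Qed.

Fact free_counit_surj (M : lmodType R) n : surjective (counit (syzygy M n)).
Proof. by move=> x; exists (free_basis x); exact: counit_basis. Qed.

Fact free_exactS (M : lmodType R) n x :
  free_diff M n x = 0 <-> exists y, free_diff M n.+1 y = x.
Proof.
rewrite -free_exact; split=> [x0|x0]; last first.
  by rewrite /free_diff /= -[counit_fun x]/(counit _ x) x0 linear0.
by apply: val_inj; rewrite [LHS]x0.
Qed.

Fact free_diffK (M : lmodType R) n x : free_diff M n (free_diff M n.+1 x) = 0.
Proof. by apply/free_exactS; exists x. Qed.

Definition free_complex (M : lmodType R) : chain_complex :=
  @ChainComplex R (fun n => free_module (syzygy M n)) (free_diff M)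
    (@free_diffK M).

(* The standard free resolution: P_n is the free module on the underlying set
   of the n-th syzygy. *)
Definition free_resolution (M : lmodType R) : resolution M :=
  @Resolution M (free_complex M) (counit M) (free_counit_surj (M := M) (n := 0))
    (@free_exact M 0) (@free_exactS M).

Definition Ext (n : nat) (M N : lmodType R) : lmodType R :=
  cohomology (free_resolution M) N n.

Definition totally_reflexive (G : lmodType R) : Prop :=
  [/\ finitely_generated G, reflexive_module G,
      forall i, (0 < i)%N -> zero_module (Ext i G R^o) &
      forall i, (0 < i)%N -> zero_module (Ext i (dual_module G) R^o)].

(* An exact sequence 0 -> X_m -> ... -> X_0 -> M -> 0 with every X_i in C is
   encoded as a resolution whose terms of index > m are zero. *)
Definition has_finite_resolution (C : lmodType R -> Prop) (M : lmodType R)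
    (m : nat) : Prop :=
  exists X : resolution M,
    (forall i, (i <= m)%N -> C (X i)) /\
    (forall i, (m < i)%N -> zero_module (X i)).

(* Infimum of a set of natural numbers, +oo if it is empty. *)
Definition inf_nat (P : nat -> Prop) : \bar int :=
  if pselect (exists n, `[< P n >]) is left ex_n
  then ((ex_minn ex_n)%:Z)%:E else +oo%E.

Definition G_dim (M : lmodType R) : \bar int :=
  inf_nat (has_finite_resolution totally_reflexive M).

Definition proj_dim (M : lmodType R) : \bar int :=
  inf_nat (has_finite_resolution projective_module M).

End Resolutions.

(* Main.v *)
Require Import Defs.
From HB Require Import structures.
From mathcomp Require Import all_boot all_order all_algebra.
From mathcomp Require Import all_classical.
From mathcomp Require Import constructive_ereal.

Set Implicit Arguments.
Unset Strict Implicit.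
Unset Printing Implicit Defensive.

Import GRing.Theory.
Local Open Scope ring_scope.

(* Write D = Hom(M, R) and E = Hom(M, M). Depth is replaced by the condition that
   every R-regular sequence s is regular on the module ([deep]); nothing is
   localized. If Ext^{>0}(A, B) = 0 and s is B-regular, then s is regular on
   Hom(A, B) and Hom(A, B)/s = Hom(A, B/s). So D is deep, and finite G-dimension
   makes it totally reflexive (Auslander-Bridger). The first syzygy M1 of M has
   the same properties, and comparing the sequence M1 -> F -> M with its bidual
   shows that M is reflexive. Hence M = Hom(D, R) and E are deep, and
   finite projective dimension makes E projective.

   Let I be the sum of the trace ideal and the annihilator of M. If I were proper,
   there would be an R-regular sequence s and y outside (s) with Iy in (s).
   Every functional on M takes yM into (s), so yM lies in sM by reflexivity and
   y id lies in sE. Every functional on E then maps id into ((s) : y), so that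
   M = ((s) : y)M by a dual basis of E, and Nakayama's lemma gives a contradiction.
   Hence I = R, which makes M a direct summand of a power of E. *)

(** * Short exact sequences and projective modules *)

Section LinearMaps.
Context {R : comPzRingType}.
Implicit Types U V W A B C N P Q X Y Z : lmodType R.

Definition mklin U V (f : U -> V) (fL : linear f) : {linear U -> V} :=
  HB.pack f (GRing.isLinear.Build R U V *:%R f fL).

(** The map is [f] after a set-theoretic section of [p]; the kernel condition makes it independent
    of the section, hence linear. *)
Lemma descend Q B N (p : {linear Q -> B}) (f : {linear Q -> N}) :
  surjective p -> (forall x, p x = 0 -> f x = 0) ->
  exists g : {linear B -> N}, forall x, g (p x) = f x.
Proof.
move=> /choice[s sP] pf.
have eqf x y : p x = p y -> f x = f y.
  by move=> e; apply/eqP; rewrite -subr_eq0 -linearB pf // linearB e subrr.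
have gL : linear (f \o s).
  by move=> a x y /=; rewrite -linearP; apply: eqf; rewrite linearP !sP.
by exists (mklin gL) => x; apply: eqf; exact: sP.
Qed.

Lemma corestrict A B C (i : {linear A -> B}) (f : {linear C -> B}) :
  injective i -> (forall c, exists a, i a = f c) ->
  exists g : {linear C -> A}, forall c, i (g c) = f c.
Proof.
move=> i_inj /choice[g gP].
have gL : linear g by move=> a x y; apply: i_inj; rewrite linearP !gP linearP.
by exists (mklin gL).
Qed.

Lemma inj_lin A B (i : {linear A -> B}) :
  (forall a, i a = 0 -> a = 0) -> injective i.
Proof.
by move=> i0 x y e; apply/eqP; rewrite -subr_eq0; apply/eqP/i0; rewrite linearB e subrr.
Qed.

Definition ses A B C (i : {linear A -> B}) (p : {linear B -> C}) : Prop :=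
  [/\ injective i, surjective p & forall b, p b = 0 <-> exists a, i a = b].

Lemma ses_comp0 A B C (i : {linear A -> B}) (p : {linear B -> C}) :
  ses i p -> forall a, p (i a) = 0.
Proof. by case=> _ _ ip a; apply/ip; exists a. Qed.

Definition ker_incl B C (p : {linear B -> C}) : {linear ker_module p -> B} :=
  @kernel_val R B C p.

Lemma ker_ses B C (p : {linear B -> C}) : surjective p -> ses (ker_incl p) p.
Proof.
move=> ps; split=> //; first exact: val_inj.
move=> b; split=> [/eqP b0|[[a a0] <-]]; last exact/eqP.
by exists (KernelElt b0).
Qed.

Definition lzero U V : {linear U -> V} := (0 : Hom_module U V).

Lemma ses_zero N V : zero_module N -> ses (lzero N V) (idfun : {linear V -> V}).
Proof.
move=> N0; split=> [x y _|x|b]; [by rewrite (N0 x) (N0 y)|by exists x|].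
by split=> [/= ->|[a <-]]; [exists 0|].
Qed.

Fact pairl_linear U V : linear (fun u : U => (u, 0 : V)).
Proof. by move=> a x y; rewrite -[RHS]/(a *: x + y, a *: 0 + 0) scaler0 addr0. Qed.

Definition pairl U V := mklin (@pairl_linear U V).

Fact pairr_linear U V : linear (fun v : V => (0 : U, v)).
Proof. by move=> a x y; rewrite -[RHS]/(a *: 0 + 0, a *: x + y) scaler0 addr0. Qed.

Definition pairr U V := mklin (@pairr_linear U V).

Lemma pairE U V (w : U * V) : w = pairl U V w.1 + pairr U V w.2.
Proof. by case: w => u v; rewrite -[RHS]/(u + 0, 0 + v) addr0 add0r. Qed.

End LinearMaps.

Section Projective.
Context {R : comPzRingType}.
Implicit Types U V W A B C N P Q X Y Z : lmodType R.

Lemma zero_projective N : zero_module N -> projective_module N.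
Proof.
move=> N0 A B p f _; exists (lzero N A) => x.
by rewrite (N0 x) !linear0.
Qed.

Lemma free_val_sum (T : choiceType) (u : @free_module R T) :
  u = \sum_(x \in supp (free_val u)) (free_val u x : R) *: free_basis x.
Proof.
apply: val_inj; apply/funext => t; rewrite /= fsbig_finite; last exact: free_finite.
rewrite linear_sum /= fct_sumE.
under eq_bigr => x _ do
  rewrite -[(_ *: _) t]/(free_val u x * (if t == x then 1 else 0)).
have [ut|ut] := boolP (free_val u t == 0).
  rewrite (eqP ut) big1 // => x _; case: eqP => [<-|_]; last by rewrite mulr0.
  by rewrite (eqP ut) mul0r.
rewrite (bigD1_seq t) ?finmap.fset_uniq //=; last first.
  by rewrite in_fset_set ?mem_setE //=; exact: free_finite.
rewrite eqxx big1 ?addr0; last first.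
  by move=> x; rewrite eq_sym => /negPf ->; rewrite mulr0.
by rewrite mulr1.
Qed.

Lemma free_projective (T : choiceType) : projective_module (@free_module R T).
Proof.
move=> A B p f ps; have [a aP] := choice (fun t => ps (f (@free_basis R T t))).
pose h (u : free_module T) := \sum_(x \in supp (free_val u)) (free_val u x : R) *: a x.
(* Enlarging the index set lets the sums for [u], [v] and [c *: u + v] be compared over one finite
   set. *)
have hE (u : free_module T) (S : set T) : finite_set S ->
    (supp (free_val u) `<=` S)%classic -> h u = \sum_(x \in S) (free_val u x : R) *: a x.
  move=> Sfin uS; apply: fsbig_widen => // x [_ /=].
  by move=> /negP; rewrite negbK => /eqP ->; rewrite scale0r.
have hL : linear h.
  move=> c u v; pose S := (supp (free_val u) `|` supp (free_val v))%classic.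
  have Sfin : finite_set S by rewrite finite_setU; split; exact: free_finite.
  have /(hE _ _ Sfin) -> : (supp (free_val u) `<=` S)%classic by move=> x; left.
  have /(hE _ _ Sfin) -> : (supp (free_val v) `<=` S)%classic by move=> x; right.
  have /(hE _ _ Sfin) -> : (supp (free_val (c *: u + v)) `<=` S)%classic.
    by rewrite linearPZ; exact: support_lin.
  rewrite !fsbig_finite //= scaler_sumr -big_split/=.
  by apply: eq_bigr => x _; rewrite scalerA -scalerDl.
exists (mklin hL) => u; rewrite {2}[u]free_val_sum /= /h.
have ufin := free_finite u.
by rewrite !fsbig_finite //= !linear_sum; apply: eq_bigr => x _; rewrite !linearZ aP.
Qed.

Lemma counit_ses A : ses (ker_incl (counit A)) (counit A).
Proof. by apply: ker_ses => x; exists (free_basis x); exact: counit_basis. Qed.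

Lemma prod_projective P Q :
  projective_module P -> projective_module Q -> projective_module (P * Q)%type.
Proof.
move=> hP hQ A B p f ps.
have [h1 h1P] := hP _ _ p (f \o pairl P Q : {linear _ -> _}) ps.
have [h2 h2P] := hQ _ _ p (f \o pairr P Q : {linear _ -> _}) ps.
exists ((h1 \o fst) \+ (h2 \o snd) : {linear (P * Q)%type -> A}) => w.
by rewrite [w in RHS]pairE [in RHS]linearD linearD h1P h2P.
Qed.

Lemma retract_projective A B (s : {linear A -> B}) (r : {linear B -> A}) :
  (forall x, r (s x) = x) -> projective_module B -> projective_module A.
Proof.
move=> rs hB X Y p f ps; have [h hP] := hB _ _ p (f \o r : {linear _ -> _}) ps.
by exists (h \o s : {linear _ -> _}) => x /=; rewrite hP /= rs.
Qed.

Lemma ses_split A B C (i : {linear A -> B}) (p : {linear B -> C}) :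
  ses i p -> projective_module C ->
  exists s : {linear C -> B}, exists2 r : {linear B -> A},
    forall c, p (s c) = c & [/\ forall a, r (i a) = a, forall c, r (s c) = 0 &
      forall b, i (r b) + s (p b) = b].
Proof.
move=> [i_inj ps ip] hC; have [s sP] := hC _ _ p (idfun : {linear C -> C}) ps.
have [|r rP] := @corestrict _ _ _ _ i (idfun \- (s \o p) : {linear B -> B}) i_inj.
  by move=> b; apply/ip; rewrite /= linearB /= sP subrr.
exists s; exists r => //; split=> [a|c|b].
- apply: i_inj; rewrite rP /=.
  have -> : p (i a) = 0 by apply/ip; exists a.
  by rewrite linear0 subr0.
- by apply: i_inj; rewrite rP /= sP subrr linear0.
- by rewrite rP /= subrK.
Qed.

Lemma extension_projective A B C (i : {linear A -> B}) (p : {linear B -> C}) :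
  ses i p -> projective_module A -> projective_module C -> projective_module B.
Proof.
move=> ip hA hC; have [s [r _ [_ _ rsE]]] := ses_split ip hC.
have srL : linear (fun b => (r b, p b)) by move=> a x y; rewrite !linearP.
apply: (@retract_projective _ _ (mklin srL) ((i \o fst) \+ (s \o snd) : {linear _ -> _}) _
  (prod_projective hA hC)) => b.
exact: rsE.
Qed.
End Projective.
(** * Vanishing of Ext *)

Section Acyclic.
Context {R : comPzRingType}.
Implicit Types U V W A B C K N P Q X Y Z : lmodType R.

Fact lpair_linear U V W (f : {linear U -> V}) (g : {linear U -> W}) :
  linear (fun x => (f x, g x)).
Proof. by move=> a x y; rewrite !linearP. Qed.

Definition lpair U V W (f : {linear U -> V}) (g : {linear U -> W}) :=
  mklin (lpair_linear f g).

(** An elementwise fibre product: the last two clauses say that W maps bijectively onto the pairs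
    agreeing in C. *)
Definition is_pullback W B P C (p : {linear B -> C}) (q : {linear P -> C})
    (w1 : {linear W -> B}) (w2 : {linear W -> P}) : Prop :=
  [/\ forall w, p (w1 w) = q (w2 w),
      forall w, w1 w = 0 -> w2 w = 0 -> w = 0 &
      forall b u, p b = q u -> exists w, w1 w = b /\ w2 w = u].

Lemma pullback_exists B P C (p : {linear B -> C}) (q : {linear P -> C}) :
  exists W (w1 : {linear W -> B}) (w2 : {linear W -> P}), is_pullback p q w1 w2.
Proof.
pose d := ((p \o fst) \- (q \o snd) : {linear (B * P)%type -> C}).
pose v := ker_incl d.
exists (ker_module d); exists (fst \o v : {linear _ -> _}).
exists (snd \o v : {linear _ -> _}); split.
- by case=> x /= x0; apply/eqP; rewrite -subr_eq0; exact: x0.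
- move=> w e1 e2; apply: val_inj.
  by rewrite [LHS]surjective_pairing [X in (X, _)]e1 [X in (_, X)]e2.
- move=> b u e.
  have bu : (b, u) \in in_kernel d by rewrite unfold_in /d /= e subrr.
  by exists (KernelElt bu).
Qed.

Lemma pullbackC W B P C (p : {linear B -> C}) (q : {linear P -> C})
    (w1 : {linear W -> B}) (w2 : {linear W -> P}) :
  is_pullback p q w1 w2 -> is_pullback q p w2 w1.
Proof.
case=> h1 h2 h3; split=> [w|w e1 e2|u b e]; [by rewrite h1|exact: h2|].
by have [|w [? ?]] := h3 b u; last by exists w.
Qed.

Lemma pullback_ses W A B P C (i : {linear A -> B}) (p : {linear B -> C})
    (q : {linear P -> C}) (w1 : {linear W -> B}) (w2 : {linear W -> P}) :
  is_pullback p q w1 w2 -> ses i p ->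
  exists2 j : {linear A -> W}, ses j w2 & forall a, w1 (j a) = i a.
Proof.
move=> [wE w0 wP] ip; have [i_inj ps ker] := ip.
have [||j jP] := @corestrict _ _ _ _ (lpair w1 w2) (pairl B P \o i : {linear A -> _}).
- by apply: inj_lin => w [w10 w20]; exact: w0.
- move=> a; have [|w [e1 e2]] := wP (i a) 0; first by rewrite (ses_comp0 ip) linear0.
  by exists w; rewrite /= e1 e2.
have j1 a : w1 (j a) = i a by case: (jP a).
have j2 a : w2 (j a) = 0 by case: (jP a).
exists j => //; split.
- by apply: inj_lin => a a0; apply: i_inj; rewrite -j1 a0 !linear0.
- move=> u; have [b bu] := ps (q u); have [w [_ w2u]] := wP b u bu; by exists w.
- move=> w; split=> [w20|[a <-] //].
  have /ker[a ai] : p (w1 w) = 0 by rewrite wE w20 linear0.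
  exists a; apply/eqP; rewrite -subr_eq0; apply/eqP/w0.
    by rewrite linearB j1 ai subrr.
  by rewrite linearB j2 w20 subrr.
Qed.

Definition extends N A B (i : {linear A -> B}) : Prop :=
  forall f : {linear A -> N}, exists g : {linear B -> N}, forall a, g (i a) = f a.

(* Coinductive form of [Ext^n(A, N) = 0 for all n > 0]: the class K records A
   together with successive syzygies, and [extends] is the vanishing of Ext^1. *)
Definition ext_acyclic A N : Prop :=
  exists K : lmodType R -> Prop, K A /\ forall B, K B ->
    exists B' Q (i : {linear B' -> Q}) (p : {linear Q -> B}),
      [/\ ses i p, projective_module Q, K B' & extends N i].

Lemma ext_acyclic_cover A N : ext_acyclic A N ->
  exists A' Q (i : {linear A' -> Q}) (p : {linear Q -> A}),
    [/\ ses i p, projective_module Q, ext_acyclic A' N & extends N i].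
Proof.
move=> [K [KA KP]]; have [A' [Q [i [p [ip hQ KA' ext]]]]] := KP _ KA.
by exists A', Q, i, p; split=> //; exists K.
Qed.

Lemma projective_acyclic A N : projective_module A -> ext_acyclic A N.
Proof.
move=> hA; exists (@projective_module R); split=> // B hB.
have Z0 : zero_module (@ker_module R B B idfun).
  by move=> [x x0]; apply: val_inj; exact/eqP.
exists (@ker_module R B B idfun), B, (lzero _ _), idfun; split=> //.
- exact: ses_zero.
- exact: zero_projective.
- by move=> f; exists (lzero _ _) => a; rewrite (Z0 a) !linear0.
Qed.

(** Vanishing of Ext^1 does not depend on the presentation of B, and Q may be any module. The chosen
    projective cover P of B maps to Q, and Q is the pushout of P and K along the syzygy B'. A map on
    K is pulled back to B', extended to P, and glued. *)
Lemma acyclic_extends K Q B N (i : {linear K -> Q}) (p : {linear Q -> B}) :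
  ext_acyclic B N -> ses i p -> extends N i.
Proof.
move=> /ext_acyclic_cover[B' [P [j [q [jq hP _ ext]]]]] ip f.
have [i_inj ps ker] := ip; have [h hE] := hP _ _ p q ps.
have [|k kE] := @corestrict _ _ _ _ i (h \o j : {linear _ -> _}) i_inj.
  by move=> b; apply/ker; rewrite /= hE (ses_comp0 jq).
have [g gE] := ext (f \o k : {linear _ -> _}).
pose s := ((h \o fst) \+ (i \o snd) : {linear (P * K)%type -> Q}).
have [||m mE] := @descend _ _ _ _ s ((g \o fst) \+ (f \o snd) : {linear _ -> _}).
- move=> x; have [_ qs _] := jq; have [u uE] := qs (p x).
  have /ker[a aE] : p (x - h u) = 0 by rewrite linearB hE uE subrr.
  by exists (u, a); rewrite /s /= aE addrC subrK.
- move=> [u a]; rewrite /s /= => e.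
  have [_ _ jker] := jq; have /jker[b bE] : q u = 0.
    by rewrite -hE -[h u](addrK (i a)) e sub0r linearN (ses_comp0 ip) oppr0.
  have : i (k b + a) = 0 by rewrite linearD kE /= bE.
  rewrite -(linear0 i) => /i_inj kba.
  by rewrite -bE gE /= -linearD kba linear0.
by exists m => a; have := mE (0, a); rewrite /s /= !linear0 !add0r.
Qed.

(** A lift [h] exists on the projective cover; its restriction to the syzygy lands in N, extends to
    the cover, and is subtracted from [h]. *)
Lemma acyclic_lift A N Y Z (i : {linear N -> Y}) (p : {linear Y -> Z})
    (f : {linear A -> Z}) :
  ext_acyclic A N -> ses i p -> exists g : {linear A -> Y}, forall a, p (g a) = f a.
Proof.
move=> /ext_acyclic_cover[A' [P [j [q [jq hP _ ext]]]]] ip.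
have [i_inj ps ker] := ip; have [h hE] := hP _ _ p (f \o q : {linear _ -> _}) ps.
have [|k kE] := @corestrict _ _ _ _ i (h \o j : {linear _ -> _}) i_inj.
  by move=> b; apply/ker; rewrite /= hE /= (ses_comp0 jq) linear0.
have [g gE] := ext k.
have [|u|m mE] := @descend _ _ _ _ q (h \- (i \o g) : {linear _ -> _}).
- by case: jq.
- case: jq => _ _ jker /jker[b <-] /=; by rewrite gE kE subrr.
exists m => a; have [_ qs _] := jq; have [u <-] := qs a.
by rewrite mE /= linearB hE /= (ses_comp0 ip) subr0.
Qed.

Lemma acyclic_zero A N : zero_module N -> ext_acyclic A N.
Proof.
move=> N0; exists (fun=> True); split=> // B _.
exists _, _, (ker_incl (counit B)), (counit B); split=> //; first exact: counit_ses.
  exact: free_projective.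
by move=> f; exists (lzero _ _) => a; rewrite [RHS]N0.
Qed.

(* Horseshoe: the product of the covers of K and B covers Q. *)
Lemma acyclic_middle K Q B N (i : {linear K -> Q}) (p : {linear Q -> B}) :
  ses i p -> ext_acyclic K N -> ext_acyclic B N -> ext_acyclic Q N.
Proof.
move=> ip aK aB; exists (fun X => exists K' B' (i' : {linear K' -> X})
  (p' : {linear X -> B'}), [/\ ses i' p', ext_acyclic K' N & ext_acyclic B' N]).
split; first by exists K, B, i, p.
move=> {K Q B i p ip aK aB} Q [K [B [i [p [ip aK aB]]]]].
have [K' [P1 [j1 [q1 [jq1 hP1 aK' ext1]]]]] := ext_acyclic_cover aK.
have [B' [P2 [j2 [q2 [jq2 hP2 aB' ext2]]]]] := ext_acyclic_cover aB.
have [i_inj ps ker] := ip; have [h hE] := hP2 _ _ p q2 ps.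
pose s := ((i \o q1 \o fst) \+ (h \o snd) : {linear (P1 * P2)%type -> Q}).
have s_surj : surjective s.
  move=> x; have [_ q2s _] := jq2; have [u uE] := q2s (p x).
  have /ker[a aE] : p (x - h u) = 0 by rewrite linearB hE uE subrr.
  have [_ q1s _] := jq1; have [v vE] := q1s a.
  by exists (v, u); rewrite /s /= vE aE subrK.
pose V := ker_incl s; have sval : ses V s := ker_ses s_surj.
have vP w : i (q1 (V w).1) + h (V w).2 = 0 := ses_comp0 sval w.
have [|j jE] := @corestrict _ _ _ _ V (pairl P1 P2 \o j1 : {linear _ -> _}) val_inj.
  move=> a; apply/(let: And3 _ _ H := sval in H).
  by rewrite /s /= (ses_comp0 jq1) !linear0 addr0.
have [|w|r rE] := @corestrict _ _ _ _ j2 (snd \o V : {linear _ -> _}).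
- by case: jq2.
- have [_ _ /(_ (V w).2)[+ _]] := jq2; apply; rewrite -hE -[h _](addKr (i (q1 (V w).1))).
  by rewrite vP addr0 linearN (ses_comp0 ip) oppr0.
(* Nine lemma: the kernels of the three covers form a short exact sequence. *)
have jr : ses j r.
  split.
  - apply: inj_lin => a a0; have [inj1 _ _] := jq1; apply: inj1.
    by have /(congr1 fst) := jE a; rewrite a0 !linear0 /= => <-.
  - move=> b; have /ker[k kE] : p (h (j2 b)) = 0 by rewrite hE (ses_comp0 jq2).
    have [_ q1s _] := jq1; have [u uE] := q1s (- k).
    have /(let: And3 _ _ H := sval in H)[w wE] : s (u, j2 b) = 0.
      by rewrite /s /= uE linearN kE addNr.
    exists w; have [inj2 _ _] := jq2; apply: inj2.
    by rewrite rE /= wE.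
  - move=> w; split=> [r0|[a <-]]; last first.
      have [inj2 _ _] := jq2; apply: inj2; rewrite rE linear0 /=.
      by have /(congr1 snd) := jE a.
    have w2 : (V w).2 = 0 by rewrite -[LHS]/((snd \o V) w) -rE r0 linear0.
    have [_ _ /(_ (V w).1)[+ _]] := jq1; case.
      by apply: i_inj; rewrite linear0 -(vP w) w2 linear0 addr0.
    move=> a aE; exists a; apply: val_inj; rewrite [LHS]jE.
    by rewrite [RHS]surjective_pairing -[X in (X, _)]aE [X in (_, X)]w2.
exists (ker_module s), (P1 * P2)%type, V, s; split=> //.
- exact: prod_projective.
- by exists K', B', j, r.
(* First extend over P1 from K'; what remains vanishes on K', factors through B', and extends over
   P2. *)
move=> f; have [a aE] := ext1 (f \o j : {linear _ -> _}).
have [|w|b bE] := @descend _ _ _ _ r (f \- (a \o fst \o V) : {linear _ -> _}).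
- by case: jr.
- case: jr => _ _ jker /jker[x <-] /=.
  by have /(congr1 fst) := jE x; rewrite /= => ->; rewrite aE subrr.
have [c cE] := ext2 b.
exists ((a \o fst) \+ (c \o snd) : {linear _ -> _}) => w /=.
rewrite -[(V w).2]/((snd \o V) w) -rE cE bE /=.
by rewrite addrC subrK.
Qed.
Lemma acyclic_of_cover B' Q B N (i : {linear B' -> Q}) (p : {linear Q -> B}) :
  ses i p -> projective_module Q -> ext_acyclic B' N -> extends N i ->
  ext_acyclic B N.
Proof.
move=> ip hQ aB' ext; exists (fun Z => ext_acyclic Z N \/ Z = B); split; first by right.
move=> Z [/ext_acyclic_cover[Z' [P [j [q [jq hP aZ' extZ]]]]]|->].
  by exists Z', P, j, q; split=> //; left.
by exists B', Q, i, p; split=> //; left.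
Qed.

(** As Y is projective, X is a summand of W and is covered by P through the retraction. The new
    kernel X' is the preimage in P of the copy of Y in W, so it is an extension of Y by W'. *)
Lemma split_kernel_cover X W Y W' P (i : {linear X -> W}) (p : {linear W -> Y})
    (j : {linear W' -> P}) (q : {linear P -> W}) :
  ses i p -> projective_module Y -> ses j q ->
  exists X' (c : {linear X' -> P}) (d : {linear P -> X}) (k : {linear W' -> X'})
      (t : {linear X' -> Y}),
    [/\ ses c d, ses k t, forall a, c (k a) = j a & forall x, t x = p (q (c x))].
Proof.
move=> ip hY jq; have [s [r ps [ri rs rsE]]] := ses_split ip hY.
have [j_inj qs jker] := jq.
pose d := (r \o q : {linear P -> X}); pose c := ker_incl d.
have ds : surjective d by move=> x; have [u uE] := qs (i x); exists u; rewrite /= uE ri.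
have cd : ses c d := ker_ses ds; have [c_inj _ cker] := cd.
have [|w|k kE] := @corestrict _ _ _ _ c j; first by case: cd.
  by apply/cker; rewrite /= (ses_comp0 jq) linear0.
exists (ker_module d), c, d, k, (p \o q \o c : {linear _ -> _}); split=> //.
split.
- by apply: inj_lin => a a0; apply: j_inj; rewrite -kE a0 !linear0.
- move=> y; have [u uE] := qs (s y).
  have /cker[x xE] : d u = 0 by rewrite /= uE rs.
  by exists x; rewrite /= xE uE ps.
- move=> x; split=> [/= tx|[a <-]]; last by rewrite /= kE (ses_comp0 jq) linear0.
  have /jker[w wE] : q (c x) = 0.
    by rewrite -[LHS]rsE -[r _]/(d (c x)) (ses_comp0 cd) tx !linear0 addr0.
  by exists w; apply: c_inj; rewrite kE.
Qed.

Lemma acyclic_split_kernel X W Y N (i : {linear X -> W}) (p : {linear W -> Y}) :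
  ses i p -> projective_module Y -> ext_acyclic W N -> ext_acyclic X N.
Proof.
move=> ip hY /ext_acyclic_cover[W' [P [j [q [jq hP aW' ext]]]]].
have [X' [c [d [k [t [cd kt kE tE]]]]]] := split_kernel_cover ip hY jq.
have aX' := acyclic_middle kt aW' (projective_acyclic N hY).
apply: (acyclic_of_cover cd hP aX') => f.
have [a aE] := ext (f \o k : {linear _ -> _}).
have [|x|b bE] := @descend _ _ _ _ t (f \- (a \o c) : {linear _ -> _}).
- by case: kt.
- by case: kt => _ _ tker /tker[w <-] /=; rewrite kE aE subrr.
exists (a \+ (b \o p \o q) : {linear _ -> _}) => x /=.
by rewrite -tE bE /= addrC subrK.
Qed.

(** Pull a projective cover P of C back along [p]. The pullback W is an extension of B by the syzygy
    of C, hence acyclic, and A is the kernel of W onto the projective P. *)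
Lemma acyclic_kernel A B C N (i : {linear A -> B}) (p : {linear B -> C}) :
  ses i p -> ext_acyclic B N -> ext_acyclic C N -> ext_acyclic A N.
Proof.
move=> ip aB /ext_acyclic_cover[C' [P [j [q [jq hP aC' _]]]]].
have [W [w1 [w2 pb]]] := pullback_exists p q.
have [k kw _] := pullback_ses (pullbackC pb) jq.
have [l lw _] := pullback_ses pb ip.
exact: acyclic_split_kernel lw hP (acyclic_middle kw aC' aB).
Qed.

(** In the pullback W of B and a free cover of C, W is an extension of the cover by A, so the syzygy
    of C is acyclic as the kernel of W onto B. The condition on [i] corrects an extension to W so
    that it vanishes on A and descends to the cover. *)
Lemma acyclic_cokernel A B C N (i : {linear A -> B}) (p : {linear B -> C}) :
  ses i p -> extends N i -> ext_acyclic A N -> ext_acyclic B N -> ext_acyclic C N.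
Proof.
move=> ip ext aA aB; have jq := counit_ses C; set j := ker_incl _ in jq.
have hP := @free_projective R C; set q := counit C in j jq.
have [W [w1 [w2 pb]]] := pullback_exists p q.
have [k kw kE] := pullback_ses (pullbackC pb) jq.
have [l lw lE] := pullback_ses pb ip.
have aW := acyclic_middle lw aA (projective_acyclic N hP).
apply: (acyclic_of_cover jq hP (acyclic_kernel kw aW aB)) => f.
have [g gE] := acyclic_extends aB kw f.
have [h hE] := ext (g \o l : {linear _ -> _}).
have [|w|m mE] := @descend _ _ _ _ w2 (g \- (h \o w1) : {linear _ -> _}).
- by case: lw.
- by case: lw => _ _ lker /lker[a <-]; rewrite /= lE hE subrr.
by exists m => c; rewrite -kE mE /= gE (ses_comp0 kw) linear0 subr0.
Qed.

(** The class of modules acyclic for both X and Y is closed under free syzygies. A map from such a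
    syzygy to Z lifts to Y, extends to the free cover there, and is projected back to Z. *)
Lemma acyclic_quotient A X Y Z (i : {linear X -> Y}) (p : {linear Y -> Z}) :
  ses i p -> ext_acyclic A X -> ext_acyclic A Y -> ext_acyclic A Z.
Proof.
move=> ip aX aY; exists (fun B => ext_acyclic B X /\ ext_acyclic B Y); split=> //.
move=> B {A aX aY} [aX aY]; have cov := counit_ses B.
have hP := @free_projective R B.
have aX' := acyclic_kernel cov (projective_acyclic X hP) aX.
have aY' := acyclic_kernel cov (projective_acyclic Y hP) aY.
exists _, _, (ker_incl (counit B)), (counit B); split=> // f.
have [g gE] := acyclic_lift f aX' ip.
have [h hE] := acyclic_extends aY cov g.
by exists (p \o h : {linear _ -> _}) => a /=; rewrite hE gE.
Qed.

(** Composed with the counit, a map on the syzygy becomes a cocycle of degree n + 1; a cochain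
    bounding it is the extension. *)
Lemma syzygy_extends A N n : zero_module (Ext n.+1 A N) ->
  extends N (ker_incl (counit (syzygy A n))).
Proof.
move=> ext0 f; pose z := (f \o counit (syzygy A n.+1) : {linear _ -> N}).
have zc : (z : Hom_module _ _) \in in_kernel (precomp N (free_diff A n.+1)).
  rewrite unfold_in; apply/eqP; apply: Hom_ext => u /=.
  have [_ _ /(_ (free_diff A n.+1 u))[_ +]] := counit_ses (syzygy A n.+1).
  rewrite /= => -> ; first exact: linear0.
  by exists (counit (syzygy A n.+2) u).
pose zz : cocycle (free_resolution A) N n.+1 := KernelElt zc.
have : (\pi_(cohomology (free_resolution A) N n.+1) zz =
        \pi_(cohomology (free_resolution A) N n.+1) 0)%qT.
  by rewrite (ext0 (\pi zz)%qT) [RHS]ext0.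
move/quotient_eqP; rewrite subr0 => /asboolP[g gE].
exists g => x; have [y yE] := (let: And3 _ s _ := counit_ses (syzygy A n.+1) in s) x.
have /(congr1 (fun h : Hom_module _ _ => (h : {linear _ -> _}) y)) := gE.
by rewrite /= -[counit_fun y]/(counit _ y) yE.
Qed.

Lemma Ext_acyclic A N : (forall n, (0 < n)%N -> zero_module (Ext n A N)) ->
  ext_acyclic A N.
Proof.
move=> ext0; exists (fun B => exists n, B = syzygy A n); split; first by exists 0%N.
move=> _ [n ->]; exists _, _, (ker_incl (counit (syzygy A n))), (counit (syzygy A n)).
split; [exact: counit_ses|exact: free_projective|by exists n.+1|].
exact/syzygy_extends/ext0.
Qed.
End Acyclic.
(** * Regular sequences *)

Section Submodules.
Context {R : comPzRingType}.
Implicit Types U V W A B C N Q : lmodType R.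

Definition submodule V (S : V -> Prop) : Prop :=
  S 0 /\ forall a x y, S x -> S y -> S (a *: x + y).

Lemma submoduleZ V (S : V -> Prop) a x : submodule S -> S x -> S (a *: x).
Proof. by move=> [S0 SP] Sx; rewrite -[_ *: _]addr0; exact: SP. Qed.

Lemma submoduleD V (S : V -> Prop) x y : submodule S -> S x -> S y -> S (x + y).
Proof. by move=> [S0 SP] Sx Sy; rewrite -[x]scale1r; exact: SP. Qed.

Lemma submoduleB V (S : V -> Prop) x y : submodule S -> S x -> S y -> S (x - y).
Proof. by move=> [S0 SP] Sx Sy; rewrite addrC -scaleN1r; exact: SP. Qed.

Lemma submodule_sum V (S : V -> Prop) (I : Type) (r : seq I) (F : I -> V) :
  submodule S -> (forall i, S (F i)) -> S (\sum_(i <- r) F i).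
Proof.
move=> Smod SF; elim/big_ind: _ => //; first by case: Smod.
by move=> x y; exact: submoduleD.
Qed.

Lemma quotient_exists V (S : V -> Prop) : submodule S ->
  exists Q (p : {linear V -> Q}), surjective p /\ forall x, p x = 0 <-> S x.
Proof.
move=> [S0 SP]; pose S' : {pred V} := fun x => `[< S x >].
have S'mod : submod_closed S'.
  by split=> [|a x y]; [exact/asboolP|move=> /asboolP Sx /asboolP Sy; exact/asboolP/SP].
have piL : linear (\pi_(quotient_module S'mod)%qT).
  move=> a x y; have e := quot_scale_pi S'mod a x.
  by rewrite raddfD; congr (_ + _); exact: esym e.
exists (quotient_module S'mod), (mklin piL); split=> [q|x].
  by elim/quotW: q => x; exists x.
rewrite -(linear0 (mklin piL)); split=> [/quotient_eqP|Sx].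
  by rewrite subr0 => /asboolP.
by apply/quotient_eqP; rewrite subr0; exact/asboolP.
Qed.

(* [in_mul s b] means b \in (s)V, and [regular_on V s] that s is a V-regular
   sequence; the head of the list s is the LAST element of the sequence. *)
Fixpoint in_mul V (s : seq R) (b : V) : Prop :=
  if s is x :: s' then exists c, in_mul s' (b - x *: c) else b = 0.

Fixpoint regular_on V (s : seq R) : Prop :=
  if s is x :: s' then
    regular_on V s' /\ forall b : V, in_mul s' (x *: b) -> in_mul s' b
  else True.

Lemma in_mul_submodule V s : submodule (@in_mul V s).
Proof.
elim: s => [|x s [IH0 IH]]; first by split=> // a x y /= -> ->; rewrite scaler0 addr0.
split=> [|a b c /= [b' hb] [c' hc]]; first by exists 0; rewrite scaler0 subr0.
exists (a *: b' + c'); have := IH a _ _ hb hc; congr (in_mul s _).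
rewrite scalerBr scalerDr !scalerA [a * x]mulrC.
by rewrite opprD addrACA.
Qed.

Lemma in_mul_lin V W (f : {linear V -> W}) s b : in_mul s b -> in_mul s (f b).
Proof.
elim: s b => [b /= ->|x s IH b /= [c /IH]]; first exact: linear0.
by rewrite linearB linearZ; exists (f c).
Qed.

Lemma in_mul_cons V x s (b : V) : in_mul s b -> in_mul (x :: s) b.
Proof. by exists 0; rewrite scaler0 subr0. Qed.

Lemma in_mul_inj V W (f : {linear V -> W}) s b :
  injective f -> surjective f -> in_mul s (f b) -> in_mul s b.
Proof.
move=> f_inj fs; elim: s b => [b /= fb0|x s IH b /= [c]].
  by apply: f_inj; rewrite fb0 linear0.
have [c' <-] := fs c; rewrite -linearZ -linearB => /IH h.
by exists c'.
Qed.

Lemma regular_iso V W (f : {linear V -> W}) s :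
  injective f -> surjective f -> regular_on W s -> regular_on V s.
Proof.
move=> f_inj fs; elim: s => //= x s IH [/IH regV h]; split=> // b hb.
apply: (in_mul_inj f_inj fs); apply: h; rewrite -linearZ; exact: in_mul_lin.
Qed.

(** This is exactness of 0 -> A/(s)A -> B/(s)B. If i(a) - xb lies in (s)B, regularity on C puts p(b)
    in (s)C, so b can be changed modulo (s)B into an element of A. *)
Lemma in_mul_kernel A B C (i : {linear A -> B}) (p : {linear B -> C}) s a :
  ses i p -> regular_on C s -> in_mul s (i a) -> in_mul s a.
Proof.
move=> [i_inj ps ker] + +; elim: s a => [a _ /= ia0|x s IH a [regC xC] /= [b hb]].
  by apply: i_inj; rewrite ia0 linear0.
have pia : p (i a) = 0 by apply/ker; exists a.
have lift c : in_mul s c -> exists2 b', in_mul s b' & p b' = c.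
  elim: {IH regC xC hb} s c => [c /= ->|y s IH c /= [c' /IH[b' hb' pb']]].
    by exists 0; rewrite ?linear0.
  have [b2 b2E] := ps c'; exists (b' + y *: b2).
    by exists b2; rewrite addrK.
  by rewrite linearD linearZ b2E pb' subrK.
have : in_mul s (p b).
  apply: xC; have := in_mul_lin p hb.
  rewrite linearB linearZ /= pia sub0r -scaleN1r.
  move=> /(submoduleZ (-1) (in_mul_submodule _ s)).
  by rewrite scalerA mulrNN mulr1 scale1r.
move=> /lift[b' hb' pb'].
have /ker[a' a'E] : p (b - b') = 0 by rewrite linearB pb' subrr.
exists a'; apply: IH => //; rewrite linearB linearZ /= a'E scalerBr opprB addrCA.
rewrite addrC; apply: submoduleD => //; first exact: in_mul_submodule.
by apply: submoduleZ => //; exact: in_mul_submodule.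
Qed.

Lemma regular_kernel A B C (i : {linear A -> B}) (p : {linear B -> C}) s :
  ses i p -> regular_on B s -> regular_on C s -> regular_on A s.
Proof.
move=> ip; elim: s => //= x s IH [regB xB] [regC xC]; split; first exact: IH.
move=> a /(in_mul_lin i); rewrite linearZ => /xB; exact: in_mul_kernel ip regC.
Qed.

(** Each step of the sequence gives an injective multiplication by [x] on B/(s), with cokernel B/(x,
    s). Acyclicity passes to this cokernel, and maps into it lift one step at a time. *)
Lemma acyclic_regular_lift A B Q (p : {linear B -> Q}) s :
  ext_acyclic A B -> regular_on B s -> surjective p ->
  (forall b, p b = 0 <-> in_mul s b) ->
  ext_acyclic A Q /\
  forall f : {linear A -> Q}, exists g : {linear A -> B}, forall a, p (g a) = f a.
Proof.
move=> aB; elim: s Q p => [|x s IH] Q p.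
  move=> _ ps ker; have Z0 : zero_module (@ker_module R B B idfun).
    by move=> [y y0]; apply: val_inj; exact/eqP.
  have zp : ses (lzero (@ker_module R B B idfun) B) p.
    split=> // [y y' _|b]; first by rewrite (Z0 y) (Z0 y').
    by rewrite ker /=; split=> [->|[a <-]//]; exists 0.
  split; first exact: acyclic_quotient zp (acyclic_zero _ Z0) aB.
  by move=> f; exact: acyclic_lift (acyclic_zero _ Z0) zp.
move=> [regB xB] ps ker.
have [Q0 [p0 [p0s ker0]]] := quotient_exists (in_mul_submodule B s).
have [aQ0 lift0] := IH _ _ regB p0s ker0.
have [|r rE] := @descend _ _ _ _ p0 p p0s.
  by move=> b /ker0 hb; apply/ker/in_mul_cons.
pose m := (x \*: idfun : {linear Q0 -> Q0}).
have mr : ses m r.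
  split.
  - apply: inj_lin => q; have [b <-] := p0s q; rewrite /m /= -linearZ => /ker0/xB hb.
    exact/ker0.
  - by move=> q; have [b <-] := ps q; exists (p0 b).
  - move=> q; have [b <-] := p0s q; rewrite rE; split=> [/ker[c hc]|[q' ]].
      exists (p0 c); apply/esym/eqP; rewrite -subr_eq0 /m /= -linearZ -linearB.
      by apply/eqP/ker0.
    have [c <-] := p0s q'; rewrite /m /= -linearZ => e.
    rewrite -rE -e rE; apply/ker; exists c; rewrite subrr.
    by case: (in_mul_submodule B s).
split; first exact: (acyclic_quotient mr aQ0 aQ0).
move=> f; have [g gE] := acyclic_lift f aQ0 mr; have [h hE] := lift0 g.
by exists h => a; rewrite -rE hE gE.
Qed.

(** Injectivity of Hom(A, B)/(s) -> Hom(A, B/(s)). Modulo the tail of the sequence f is x times a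
    map into the quotient; that map lifts to some [h] from A to B, and induction applies to f -
    xh. *)
Lemma in_mul_Hom A B s (f : Hom_module A B) :
  ext_acyclic A B -> regular_on B s ->
  (forall a, in_mul s ((f : {linear A -> B}) a)) -> in_mul s f.
Proof.
move=> aB; elim: s f => [f _ /= f0|x s IH f [regB xB] fs]; first exact: Hom_ext.
have [Q0 [p0 [p0s ker0]]] := quotient_exists (in_mul_submodule B s).
have [aQ0 lift0] := acyclic_regular_lift aB regB p0s ker0.
have [||g gE] := @corestrict _ _ _ _ (x \*: idfun : {linear Q0 -> Q0})
  (p0 \o (f : {linear A -> B}) : {linear A -> Q0}).
- apply: inj_lin => q; have [b <-] := p0s q; rewrite /= -linearZ => /ker0/xB hb.
  exact/ker0.
- move=> a; have /= [c hc] := fs a; exists (p0 c); apply/esym/eqP.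
  by rewrite -subr_eq0 /= -linearZ -linearB; apply/eqP/ker0.
have [h hE] := lift0 g; exists (h : Hom_module A B); apply: IH => // a.
by apply/ker0; rewrite /= linearB linearZ /= hE; have /= -> := gE a; rewrite subrr.
Qed.

Lemma regular_Hom A B s :
  ext_acyclic A B -> regular_on B s -> regular_on (Hom_module A B) s.
Proof.
move=> aB; elim: s => //= x s IH [regB xB]; split; first exact: IH.
move=> f xf; apply: in_mul_Hom => // a; apply: xB.
have evL : linear (fun g : Hom_module A B => (g : {linear A -> B}) a) by [].
exact: (in_mul_lin (mklin evL) xf).
Qed.
End Submodules.
(** * Noetherian rings *)

Section FiniteGeneration.
Context {R : comPzRingType}.
Implicit Types U V W A B C K N Q : lmodType R.

Fixpoint in_span V (l : seq V) (x : V) : Prop :=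
  if l is g :: l' then exists c : R, in_span l' (x - c *: g) else x = 0.

Definition fin_gen V (S : V -> Prop) : Prop :=
  exists l : seq V, forall x, S x <-> in_span l x.

Definition noetherian_module V : Prop :=
  forall S : V -> Prop, submodule S -> fin_gen S.

Definition fg_module V : Prop := exists l : seq V, forall x, in_span l x.

Lemma in_span_submodule V (l : seq V) : submodule (in_span l).
Proof.
elim: l => [|g l [IH0 IH]]; first by split=> // a x y /= -> ->; rewrite scaler0 addr0.
split=> [|a x y /= [c hc] [d hd]]; first by exists 0; rewrite scale0r subr0.
exists (a * c + d); have := IH a _ _ hc hd; congr (in_span l _).
by rewrite scalerBr scalerDl scalerA opprD addrACA.
Qed.

Lemma in_span_mem V (l : seq V) x : x \in l -> in_span l x.
Proof.
have sub0 (l' : seq V) : in_span l' 0 by case: (in_span_submodule l').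
elim: l => //= g l IH; rewrite inE => /orP[/eqP ->|/IH h].
  by exists 1; rewrite scale1r subrr.
by exists 0; rewrite scale0r subr0.
Qed.

Lemma in_span_sub V (S : V -> Prop) (l : seq V) x :
  submodule S -> (forall g, g \in l -> S g) -> in_span l x -> S x.
Proof.
move=> Smod; elim: l x => [|g l IH] x Sl /=; first by move=> ->; case: Smod.
move=> [c /IH Sx]; rewrite -[x](subrK (c *: g)); apply: submoduleD => //.
  by apply: Sx => y yl; apply: Sl; rewrite inE yl orbT.
by apply: submoduleZ => //; apply: Sl; rewrite inE eqxx.
Qed.

Lemma in_span_map V W (f : {linear V -> W}) (l : seq V) x :
  in_span l x -> in_span (map f l) (f x).
Proof.
elim: l x => [x /= ->|g l IH x /= [c /IH]]; first exact: linear0.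
by rewrite linearB linearZ; exists c.
Qed.

Lemma in_span_lift V W (f : {linear V -> W}) (l : seq V) y :
  in_span (map f l) y -> exists2 x, in_span l x & f x = y.
Proof.
elim: l y => [y /= ->|g l IH y /= [c /IH[x hx fx]]]; first by exists 0; rewrite ?linear0.
exists (x + c *: g); first by exists c; rewrite addrK.
by rewrite linearD linearZ fx subrK.
Qed.

Lemma lift_seq V W (f : {linear V -> W}) (S : V -> Prop) (l : seq W) :
  (forall y, y \in l -> exists2 x, S x & f x = y) ->
  exists2 l', map f l' = l & forall x, x \in l' -> S x.
Proof.
elim: l => [|y l IH] hl; first by exists [::].
have [|l' l'E l'S] := IH; first by move=> z zl; apply: hl; rewrite inE zl orbT.
have [|x Sx xE] := hl y; first by rewrite inE eqxx.
exists (x :: l'); first by rewrite /= xE l'E.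
by move=> z; rewrite inE => /orP[/eqP ->|/l'S].
Qed.

Lemma finitely_generated_fg V : finitely_generated V -> fg_module V.
Proof.
move=> [n [g gP]]; exists [seq g i | i <- enum 'I_n] => x; have [c ->] := gP x.
have Smod := in_span_submodule [seq g i | i <- enum 'I_n].
apply: submodule_sum => // i; apply: submoduleZ => //.
by apply/in_span_mem/map_f; rewrite mem_enum.
Qed.

Lemma noetherian_regular : noetherian R -> noetherian_module R^o.
Proof.
move=> noethR S Smod; pose I : {pred R^o} := fun x => `[< S x >].
have [|n [g gP]] := noethR I.
  split=> [|a x y]; first by apply/asboolP; case: Smod.
  by move=> /asboolP Sx /asboolP Sy; apply/asboolP; case: Smod => _; exact.
have gS i : S (g i).
  apply/asboolP/(gP (g i)); exists (fun j => (i == j)%:R).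
  rewrite (bigD1 i) //= eqxx scale1r big1 ?addr0 // => j.
  by rewrite eq_sym => /negPf ->; rewrite scale0r.
exists [seq g i | i <- enum 'I_n] => x; split=> [Sx|].
  have Lmod := in_span_submodule [seq g i | i <- enum 'I_n].
  have /gP[c ->] : x \in I by exact/asboolP.
  apply: submodule_sum => // i; apply: submoduleZ => //.
  by apply/in_span_mem/map_f; rewrite mem_enum.
by apply: in_span_sub => // _ /mapP[i _ ->].
Qed.

Lemma fin_gen_extension V W (f : {linear V -> W}) (S : V -> Prop) :
  submodule S -> fin_gen (fun y => exists2 x, S x & f x = y) ->
  fin_gen (fun x => S x /\ f x = 0) -> fin_gen S.
Proof.
move=> Smod [lW lWP] [lK lKP].
have [|lV lVE lVS] := @lift_seq _ _ f S lW; first by move=> y /in_span_mem/lWP.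
exists (lV ++ lK) => x; have Lmod := in_span_submodule (lV ++ lK); split=> [Sx|].
  have : in_span lW (f x) by apply/lWP; exists x.
  rewrite -lVE => /in_span_lift[x' hx' fx'].
  have Sx' : S x' by exact: in_span_sub hx'.
  rewrite -[x](subrK x'); apply: submoduleD => //.
    have : in_span lK (x - x').
      by apply/lKP; split; [exact: submoduleB|rewrite linearB fx' subrr].
    by apply: in_span_sub => // y yl; apply: in_span_mem; rewrite mem_cat yl orbT.
  by apply: in_span_sub hx' => // y yl; apply: in_span_mem; rewrite mem_cat yl.
apply: in_span_sub => // y; rewrite mem_cat => /orP[/lVS //|yl].
by have /lKP[] := in_span_mem yl.
Qed.

(** Such a V embeds in a finite power of W. This one criterion serves for free modules, submodules
    and Hom modules. *)
Lemma noetherian_separated (I : eqType) V W (F : I -> {linear V -> W}) (r : seq I) :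
  noetherian_module W ->
  (forall x, (forall i, i \in r -> F i x = 0) -> x = 0) -> noetherian_module V.
Proof.
move=> noethW sep S Smod.
(* Separation is required only on [S], so that the induction can pass to the part of [S] killed by
   one map. *)
have {sep} : forall x, S x -> (forall i, i \in r -> F i x = 0) -> x = 0.
  by move=> x _; exact: sep.
elim: r S Smod => [|i r IH] S Smod sep.
  exists [::] => x; split=> [Sx|->]; first exact: sep.
  by case: Smod.
apply: (@fin_gen_extension _ _ (F i)) => //.
  apply: noethW; split=> [|a _ _ [x Sx <-] [y Sy <-]].
    by exists 0; [case: Smod|exact: linear0].
  by exists (a *: x + y); [case: Smod => _; exact|exact: linearP].
apply: IH => [|x [Sx Fx] hx].
  split=> [|a x y [Sx Fx] [Sy Fy]]; first by split; [case: Smod|exact: linear0].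
  by split; [case: Smod => _; exact|rewrite linearP Fx Fy scaler0 addr0].
by apply: sep => // j; rewrite inE => /orP[/eqP ->|/hx].
Qed.

Lemma noetherian_surj V W (f : {linear V -> W}) :
  surjective f -> noetherian_module V -> noetherian_module W.
Proof.
move=> fs noethV S Smod; have [|l lP] := noethV (fun x => S (f x)).
  by split=> [|a x y Sx Sy]; rewrite ?linear0 ?linearP; case: Smod => // _; exact.
exists (map f l) => y; split=> [Sy|/in_span_lift[x /lP hx <-] //].
by have [x xE] := fs y; rewrite -xE in Sy *; apply/in_span_map/lP.
Qed.

Lemma fg_free_cover V : fg_module V ->
  exists n (p : {linear 'rV[R]_n -> V}), surjective p.
Proof.
move=> [l lP]; pose p (u : 'rV[R]_(size l)) := \sum_i u 0 i *: l`_i.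
have pL : linear p.
  move=> a x y; rewrite /p scaler_sumr -big_split; apply: eq_bigr => i _ /=.
  by rewrite !mxE scalerDl scalerA.
exists (size l), (mklin pL) => x.
have [c ->] : exists c : nat -> R, x = \sum_(i < size l) c i *: l`_i.
  have := lP x; elim: {lP p pL} l x => [x /= ->|g l IH x /= [a /IH[c cE]]].
    by exists (fun=> 0); rewrite big_ord0.
  exists (fun i => if i is j.+1 then c j else a).
  by rewrite big_ord_recl /= -cE addrC subrK.
by exists (\row_i c i); apply: eq_bigr => i _; rewrite mxE.
Qed.

Lemma fg_surj V W (f : {linear V -> W}) : surjective f -> fg_module V -> fg_module W.
Proof.
move=> fs [l lP]; exists (map f l) => y.
by have [x <-] := fs y; exact: in_span_map.
Qed.

Lemma noetherian_fg V : noetherian_module V -> fg_module V.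
Proof. by move=> /(_ (fun=> True))[//|l lP]; exists l => x; apply/lP. Qed.

Hypothesis noethR : noetherian R.

Lemma fg_noetherian V : fg_module V -> noetherian_module V.
Proof.
move=> /fg_free_cover[n [p ps]]; apply: noetherian_surj ps _.
have coordL (i : 'I_n) : linear (fun u : 'rV[R]_n => u 0 i : R^o).
  by move=> a x y; rewrite !mxE.
apply: (@noetherian_separated _ _ _ (fun i => mklin (coordL i)) (enum 'I_n)).
  exact: noetherian_regular.
by move=> u hu; apply/rowP => i; rewrite mxE; apply: hu; rewrite mem_enum.
Qed.

Lemma fg_injective K V (i : {linear K -> V}) :
  injective i -> fg_module V -> fg_module K.
Proof.
move=> i_inj /fg_noetherian noethV; apply: noetherian_fg.
apply: (@noetherian_separated _ _ _ (fun=> i) [:: tt]) => // x hx.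
by apply: i_inj; rewrite linear0; exact: (hx tt).
Qed.

Lemma fg_Hom A B : fg_module A -> fg_module B -> fg_module (Hom_module A B).
Proof.
move=> [l lP] /fg_noetherian noethB; apply: noetherian_fg.
have evL (a : A) : linear (fun g : Hom_module A B => (g : {linear A -> B}) a) by [].
apply: (@noetherian_separated _ _ _ (fun a => mklin (evL a)) l) => // f hf.
apply: Hom_ext => a /=; apply: (@in_span_sub _ (fun x => f x = 0) l) => //.
by split=> [|c x y fx fy]; rewrite ?linear0 // linearP fx fy scaler0 addr0.
Qed.
End FiniteGeneration.

(** * Maximal annihilators, prime avoidance and maximal regular sequences *)

Section Noetherian.
Context {R : comPzRingType}.
Implicit Types U V W : lmodType R.

(** Without a maximal member, choice yields a strictly increasing chain; its union is finitely
    generated, so it already equals some term. *)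
Lemma maximal_submodule V (F : (V -> Prop) -> Prop) S0 :
  noetherian_module V -> (forall S, F S -> submodule S) -> F S0 ->
  exists2 S, F S &
    forall T, F T -> (forall x, S x -> T x) -> forall x, T x -> S x.
Proof.
move=> noethV Fmod FS0; apply: contrapT => noMax.
have step (S : {S | F S}) : exists T : {T | F T},
    (forall x, sval S x -> sval T x) /\ exists2 x, sval T x & ~ sval S x.
  case: S => S FS; apply: contrapT => h; apply: noMax; exists S => // T FT ST x Tx.
  by apply: contrapT => nSx; apply: h; exists (exist _ T FT); split=> //; exists x.
have [next nextP] := choice step; pose u n := iter n next (exist _ S0 FS0).
have u_le m n : (m <= n)%N -> forall x, sval (u m) x -> sval (u n) x.
  move=> /subnK <-; elim: (n - m)%N => // k IH x /IH; rewrite addSn /u iterS.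
  by case: (nextP (u (k + m)%N)) => h _; exact: h.
have uM n : submodule (sval (u n)) := Fmod _ (svalP (u n)).
have [|l lP] := noethV (fun x => exists n, sval (u n) x).
  split=> [|a x y [m um] [n un]]; first by exists 0%N; case: (uM 0%N).
  exists (maxn m n); case: (uM (maxn m n)) => _; apply.
    exact: u_le (leq_maxl _ _) _ um.
  exact: u_le (leq_maxr _ _) _ un.
have [n nP] : exists n, forall x, x \in l -> sval (u n) x.
  have {lP} : forall x, x \in l -> exists n, sval (u n) x by move=> x /in_span_mem/lP.
  elim: l => [|x l IH] hl; first by exists 0%N.
  have [|n nP] := IH; first by move=> y yl; apply: hl; rewrite inE yl orbT.
  have [|m mP] := hl x; first by rewrite inE eqxx.
  exists (maxn m n) => y; rewrite inE => /orP[/eqP ->|/nP].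
    exact: u_le (leq_maxl _ _) _ mP.
  exact: u_le (leq_maxr _ _) _.
have [_ [x ux nux]] := nextP (u n); apply: nux.
by apply: in_span_sub (uM n) nP _; apply/lP; exists n.+1.
Qed.

Section ZeroDivisors.
Variables (noethR : noetherian_module (R^o : lmodType R)) (J m : R^o -> Prop).
Hypotheses (Jmod : submodule J) (mmod : submodule m).

(** The colon ideal (J : y) is maximal among all (J : b) with b outside J. *)
Let maximal_ann (y : R) : Prop := ~ J y /\
  forall b, ~ J b -> (forall a, J (a * y) -> J (a * b)) ->
  forall a, J (a * b) -> J (a * y).

Let JM (a x : R) : J x -> J (a * x).
Proof. exact: (@submoduleZ R R^o J a x Jmod). Qed.

Let ann_submodule y : submodule (fun a : R^o => J (a * y)).
Proof.
split=> [|a x z Jx Jz]; first by rewrite mul0r; case: Jmod.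
by rewrite mulrDl -mulrA; apply: submoduleD => //; exact: JM.
Qed.

Let maximal_ann_exists b : ~ J b ->
  exists2 y, maximal_ann y & forall a, J (a * b) -> J (a * y).
Proof.
move=> nJb.
have [||S [y [nJy by_ ->]] Smax] := @maximal_submodule _ (fun S => exists y,
  [/\ ~ J y, forall a, J (a * b) -> J (a * y) & S = fun a : R^o => J (a * y)])
  (fun a : R^o => J (a * b)) noethR.
- by move=> S [y [_ _ ->]]; exact: ann_submodule.
- by exists b.
exists y => //; split=> // c nJc yc.
by apply: Smax => //; exists c; split=> // a /by_/yc.
Qed.

(** If ay is outside J, then (J : y) is contained in (J : ay), and maximality makes them equal. *)
Let maximal_ann_prime y a c : maximal_ann y -> J (a * c * y) -> J (a * y) \/ J (c * y).
Proof.
move=> [nJy ymax] Jacy; have [|nJay] := pselect (J (a * y)); first by left.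
right; apply: (ymax (a * y)) => //; last by rewrite mulrA [c * a]mulrC.
by move=> d /(JM a); rewrite mulrCA.
Qed.

(** The product of the given elements works, since (J : y) is prime. *)
Let separate y (l : seq R) : maximal_ann y ->
  (forall y', y' \in l -> exists2 z, J (z * y') & ~ J (z * y)) ->
  exists2 z, ~ J (z * y) & forall y', y' \in l -> J (z * y').
Proof.
move=> ymax; elim: l => [|y' l IH] hl.
  by exists 1 => //; rewrite mul1r; case: ymax.
have [|z nJz zl] := IH; first by move=> w wl; apply: hl; rewrite inE wl orbT.
have [|w Jw nJw] := hl y'; first by rewrite inE eqxx.
exists (w * z); first by case/(maximal_ann_prime ymax).
move=> v; rewrite inE => /orP[/eqP ->|/zl Jz]; last by rewrite -mulrA; exact: JM.
by rewrite mulrAC mulrC; exact: JM.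
Qed.

(** Otherwise (J : y') would be contained in (J : y), hence equal to it by maximality, although x
    lies in only one of them. *)
Let absorb x y y' : maximal_ann y -> maximal_ann y' -> J (x * y) -> ~ J (x * y') ->
  exists2 z, J (z * y') & ~ J (z * y).
Proof.
move=> [nJy ymax] [nJy' y'max] Jxy nJxy'; apply: contrapT => h; apply: nJxy'.
apply: (y'max y) => // a Ja; apply: contrapT => nJa; apply: h; by exists a.
Qed.

(** Prime avoidance by induction: if x falls into the new prime (J : y), add a multiple az with a in
    m outside (J : y) and z in all the earlier primes but not in (J : y). *)
Let avoid (l : seq R) : (forall y, ~ J y -> exists2 a, m a & ~ J (a * y)) ->
  (forall y, y \in l -> maximal_ann y) ->
  exists2 x, m x & forall y, y \in l -> ~ J (x * y).
Proof.
move=> hm; elim: l => [_|y l IH hl]; first by exists 0 => //; case: mmod.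
have [|x mx xl] := IH; first by move=> z zl; apply: hl; rewrite inE zl orbT.
have ymax : maximal_ann y by apply: hl; rewrite inE eqxx.
have [Jxy|nJxy] := pselect (J (x * y)); last first.
  by exists x => // z; rewrite inE => /orP[/eqP ->|/xl].
have [y' y'l|z nJz zl] := separate ymax (l := l).
  by apply: absorb (ymax) _ Jxy (xl _ y'l); apply: hl; rewrite inE y'l orbT.
have [a ma nJa] := hm y (let: conj h _ := ymax in h).
exists (x + a * z).
  by apply: submoduleD => //; rewrite mulrC; exact: submoduleZ.
move=> w; rewrite inE mulrDl => /orP[/eqP ->|wl] Jw.
  have : J (a * z * y) by rewrite -[_ * y](addKr (x * y)) addrC; apply: submoduleB.
  by case/(maximal_ann_prime ymax).
apply: (xl w wl); rewrite -[_ * w](addrK (a * z * w)); apply: submoduleB => //.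
by rewrite -mulrA; apply/JM/zl.
Qed.

(* The associated primes of J that are maximal annihilators are finite in number,
   which allows prime avoidance. *)
Lemma zero_divisors_annihilated :
  (forall x, m x -> exists2 b, ~ J b & J (x * b)) ->
  exists2 y, ~ J y & forall x, m x -> J (x * y).
Proof.
move=> zd; apply: contrapT => noy.
have hm y : ~ J y -> exists2 a, m a & ~ J (a * y).
  move=> nJy; apply: contrapT => h; apply: noy; exists y => // x mx.
  by apply: contrapT => nJxy; apply: h; exists x.
have [||S [l lmax ->] Smax] := @maximal_submodule _ (fun S => exists2 l : seq R^o,
  (forall y, y \in l -> maximal_ann y) & S = in_span l) (in_span [::]) noethR.
- by move=> S [l _ ->]; exact: in_span_submodule.
- by exists [::].
(* By maximality the finite list [l] spans every element whose annihilator is maximal. *)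
have spanl (y : R^o) : maximal_ann y -> in_span l y.
  move=> ymax; apply: (Smax (in_span (y :: l))).
  - by exists (y :: l) => // z; rewrite inE => /orP[/eqP ->|/lmax].
  - by move=> x hx; exists 0; rewrite scale0r subr0.
  - by apply: in_span_mem; rewrite inE eqxx.
have [x mx xl] := avoid hm lmax; have [b nJb Jxb] := zd x mx.
have [y ymax /(_ _ Jxb) Jxy] := maximal_ann_exists nJb.
(* As x lies in (J : y) but in no (J : y') for y' in [l], some z multiplies all of [l] into J but
   not y, although y is in the span of [l]. *)
have [y' y'l|z nJz zl] := separate ymax (l := l).
  exact: absorb ymax (lmax _ y'l) Jxy (xl _ y'l).
apply: nJz; apply: (@in_span_sub _ _ (fun v : R^o => J (z * v)) l) (spanl y ymax) => //.
split=> [|a v w Jv Jw]; first by rewrite mulr0; case: Jmod.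
have -> : z * (a *: v + w) = a * (z * v) + z * w by rewrite mulrDr mulrCA.
exact: (submoduleD Jmod (JM a Jv) Jw).
Qed.
End ZeroDivisors.

(** Take (s) maximal among the ideals generated by regular sequences inside m. Then m consists of
    zero divisors modulo (s): a regular x could be appended, forcing x into (s) and hence 1 into
    m. *)
Lemma regular_sequence_exists (m : R^o -> Prop) :
  noetherian_module (R^o : lmodType R) -> submodule m -> ~ m 1 ->
  exists s (y : R^o), [/\ regular_on R^o s, ~ in_mul s y &
    forall x, m x -> in_mul s (x * y : R^o)].
Proof.
move=> noethR mmod m1.
have [||S [s [regs sm ->]] Smax] := @maximal_submodule _ (fun S => exists s,
  [/\ regular_on R^o s, forall x, in_mul s x -> m x & S = @in_mul R R^o s])
  (@in_mul R R^o [::]) noethR.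
- by move=> S [s [_ _ ->]]; exact: in_mul_submodule.
- by exists [::]; split=> // x /= ->; case: mmod.
have [x mx|y nJy yP] := zero_divisors_annihilated noethR (in_mul_submodule R^o s) mmod.
  apply: contrapT => xreg.
  have xinj b : in_mul s (x *: b : R^o) -> in_mul s b.
    by move=> hb; apply: contrapT => nb; apply: xreg; exists b.
  apply: m1; apply/sm/xinj/(Smax (in_mul (x :: s))).
  - exists (x :: s); split=> // z /= [c /sm mz]; rewrite -[z](subrK (x *: c)).
    apply: (submoduleD mmod mz); have := submoduleZ c mmod mx.
    by rewrite [c *: x]mulrC.
  - by move=> z; exact: in_mul_cons.
  - by exists 1; rewrite subrr; case: (in_mul_submodule R^o s).
by exists s, y.
Qed.
End Noetherian.

(** * Nakayama's lemma in determinant-free form *)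

Section Nakayama.
Context {R : comPzRingType} {V : lmodType R}.

Lemma nakayama (b : R^o -> Prop) : submodule b -> fg_module V ->
  (forall v : V, exists n (c : 'I_n -> R) (w : 'I_n -> V),
    (forall i, b (c i)) /\ v = \sum_i c i *: w i) ->
  exists2 s : R, b (1 - s) & forall v : V, s *: v = 0.
Proof.
move=> bmod [l lP] bV.
have {lP} : exists2 s : R, b (1 - s) & forall v, in_span l (s *: v).
  by exists 1; [rewrite subrr; case: bmod|move=> v; rewrite scale1r].
have bM (a x : R) : b x -> b (a * x) by exact: (@submoduleZ R R^o b a x bmod).
elim: l => [|g l IH] // [s bs sP]; apply: IH.
have lmod := in_span_submodule l.
have [c bc cP] : exists2 c : R, b c & in_span l (s *: g - c *: g).
  have [n [c [w [bc gE]]]] := bV g.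
  have [d dP] := choice (fun i => sP (w i)).
  exists (\sum_i c i * d i).
    apply: (@submodule_sum R R^o b _ _ _ bmod) => i; rewrite mulrC; exact: bM.
  rewrite {1}gE scaler_sumr scaler_suml -sumrB; apply: submodule_sum => // i.
  have -> : s *: (c i *: w i) - (c i * d i) *: g = c i *: (s *: w i - d i *: g).
    by rewrite scalerBr !scalerA [c i * s]mulrC.
  exact: (submoduleZ _ lmod (dP i)).
(* The factor s moves any v into the span of g and [l], and s - c moves g into the span of [l]; both
   factors are 1 modulo b. *)
exists ((s - c) * s).
  have -> : 1 - (s - c) * s = (1 + s) * (1 - s) + s * c.
    by rewrite mulrBl [c * s]mulrC mulrDl mul1r mulrBr mulr1 addrA subrK
      opprB addrCA [LHS]addrC.
  exact: (submoduleD bmod (bM _ _ bs) (bM _ _ bc)).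
move=> v; have /= [d dP] := sP v.
rewrite -scalerA -[s *: v](subrK (d *: g)) scalerDr; apply: submoduleD => //.
  exact: submoduleZ.
rewrite scalerA mulrC -scalerA scalerBl; exact: submoduleZ.
Qed.
End Nakayama.
(** * Duality and finite G-dimension *)

Section DualBasis.
Context {R : comPzRingType}.
Implicit Types U V W A B C K N P Q : lmodType R.

(** By the dual basis lemma these are the finitely generated projective modules. *)
Definition dual_basis P : Prop :=
  exists n (e : 'I_n -> P) (g : 'I_n -> {linear P -> R^o}),
    forall x, x = \sum_i (g i x : R) *: e i.

Lemma dual_basis_projective P : dual_basis P -> projective_module P.
Proof.
move=> [n [e [g eg]]] A B p f ps; have [a aE] := choice (fun i => ps (f (e i))).
have hL : linear (fun x => \sum_i (g i x : R) *: a i).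
  move=> c x y; rewrite scaler_sumr -big_split; apply: eq_bigr => i _ /=.
  by rewrite linearP scalerDl scalerA.
exists (mklin hL) => x; rewrite [in RHS](eg x) /= !linear_sum.
by apply: eq_bigr => i _; rewrite !linearZ aE.
Qed.

Lemma rV_dual_basis n : dual_basis 'rV[R]_n.
Proof.
have coordL (i : 'I_n) : linear (fun u : 'rV[R]_n => u 0 i : R^o).
  by move=> a x y; rewrite !mxE.
exists n, (delta_mx 0), (fun i => mklin (coordL i)) => x.
exact: row_sum_delta.
Qed.

Lemma projective_dual_basis P : fg_module P -> projective_module P -> dual_basis P.
Proof.
move=> /fg_free_cover[n [p ps]] hP; have [h hE] := hP _ _ p (idfun : {linear P -> P}) ps.
have [m [e [g eg]]] := rV_dual_basis n.
exists m, (p \o e), (fun i => g i \o h : {linear P -> R^o}) => x.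
rewrite -[LHS]hE [h x]eg linear_sum; by apply: eq_bigr => i _; rewrite linearZ.
Qed.

Lemma dual_basis_fg P : dual_basis P -> fg_module P.
Proof.
move=> [n [e [g eg]]]; apply: finitely_generated_fg.
by exists n, e => x; exists (fun i => g i x).
Qed.

Fact eval_linear U V (x : U) : linear (fun f : Hom_module U V => (f : {linear U -> V}) x).
Proof. by []. Qed.

Definition eval U V (x : U) : {linear Hom_module U V -> V} := mklin (@eval_linear U V x).

Lemma dual_expand P n (e : 'I_n -> P) (g : 'I_n -> {linear P -> R^o}) :
  (forall x, x = \sum_i (g i x : R) *: e i) -> forall f : {linear P -> R^o},
  f = \sum_i (f (e i) : R) *: (g i : dual_module P) :> dual_module P.
Proof.
move=> eg f; apply: Hom_ext => x; rewrite [in LHS](eg x) linear_sum.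
rewrite -[RHS]/(eval R^o x _) linear_sum; apply: eq_bigr => i _.
by rewrite !linearZ /=; exact: mulrC.
Qed.

Lemma dual_basis_dual P : dual_basis P -> dual_basis (dual_module P).
Proof.
move=> [n [e [g eg]]]; exists n, g, (fun i => biduality (e i)) => f.
exact: dual_expand.
Qed.

Lemma dual_basis_biduality_inj P : dual_basis P -> injective (@biduality R P).
Proof.
move=> [n [e [g eg]]]; apply: inj_lin => x x0; rewrite (eg x) big1 // => i _.
have : g i x = 0.
  exact: (congr1 (fun f : dual_module (dual_module P) =>
    (f : {linear dual_module P -> R^o}) (g i)) x0).
by move=> ->; rewrite scale0r.
Qed.

Lemma dual_basis_biduality_surj P : dual_basis P -> surjective (@biduality R P).
Proof.
move=> [n [e [g eg]]] t; pose t' : {linear dual_module P -> R^o} := t.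
exists (\sum_i (t' (g i) : R) *: e i); apply: Hom_ext => f.
rewrite -[LHS]/((f : {linear P -> R^o}) _) -[RHS]/(t' f).
rewrite [in RHS](dual_expand eg f) !linear_sum; apply: eq_bigr => i _.
by rewrite !linearZ /=; exact: mulrC.
Qed.
End DualBasis.

(** * Totally reflexive modules and deep modules of finite G-dimension *)

Section TotallyReflexive.
Context {R : comPzRingType}.
Hypothesis noethR : noetherian R.
Implicit Types U V W A B C D G K N P Q : lmodType R.

(** Total reflexivity with [ext_acyclic] for the Ext conditions; the two halves of reflexivity are
    kept apart because they are proved separately. *)
Definition gproj G : Prop :=
  [/\ fg_module G, injective (@biduality R G), surjective (@biduality R G),
      ext_acyclic G R^o & ext_acyclic (dual_module G) R^o].

(* In the local case this says depth V >= depth R. *)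
Definition deep V : Prop := forall s, regular_on R^o s -> regular_on V s.

Lemma totally_reflexive_gproj G : totally_reflexive G -> gproj G.
Proof.
move=> [fgG [b bK Kb] extG extG']; split.
- exact: finitely_generated_fg.
- exact: can_inj bK.
- by move=> t; exists (b t); rewrite Kb.
- exact: Ext_acyclic.
- exact: Ext_acyclic.
Qed.

Lemma dual_basis_gproj P : dual_basis P -> gproj P.
Proof.
move=> dP; split.
- exact: dual_basis_fg.
- exact: dual_basis_biduality_inj.
- exact: dual_basis_biduality_surj.
- exact/projective_acyclic/dual_basis_projective.
- exact/projective_acyclic/dual_basis_projective/dual_basis_dual.
Qed.

Lemma deep_Hom A B : ext_acyclic A B -> deep B -> deep (Hom_module A B).
Proof. by move=> aAB deepB s /deepB; exact: regular_Hom. Qed.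

Lemma deep_regular : deep R^o.
Proof. by move=> s. Qed.

Lemma deep_iso V W (f : {linear V -> W}) :
  injective f -> surjective f -> deep W -> deep V.
Proof. by move=> f_inj fs deepW s /deepW; exact: regular_iso f_inj fs. Qed.

Lemma gproj_deep G : gproj G -> deep G.
Proof.
move=> [_ inj surj _ aG]; apply: deep_iso inj surj _.
exact: deep_Hom aG deep_regular.
Qed.

Lemma deep_kernel A B C (i : {linear A -> B}) (p : {linear B -> C}) :
  ses i p -> deep B -> deep C -> deep A.
Proof. by move=> ip dB dC s rs; apply: (regular_kernel ip); [exact: dB|exact: dC]. Qed.

Lemma fg_dual V : fg_module V -> fg_module (dual_module V).
Proof.
move=> fgV; apply: (fg_Hom noethR fgV).
by exists [:: (1 : R^o)] => x; exists x; rewrite /= -[x *: _]/(x * 1) mulr1 subrr.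
Qed.

(** Adjoin the generators to S one by one: the generator that first makes the submodule everything
    generates the quotient just before it. *)
Lemma cyclic_quotient_exists V (S : V -> Prop) v0 :
  fg_module V -> submodule S -> ~ S v0 ->
  exists (T : V -> Prop) v, [/\ submodule T, forall x, S x -> T x, ~ T v &
    forall x, exists a : R, T (x - a *: v)].
Proof.
move=> [l lP] Smod Sv0.
have {lP} hl : forall x, exists2 y, in_span l y & S (x - y).
  by move=> x; exists x => //; rewrite subrr; case: Smod.
elim: l S v0 Smod Sv0 hl => [|g l IH] S v0 Smod Sv0 hl.
  by have [_ /= ->] := hl v0; rewrite subr0.
pose S1 x := exists a : R, S (x - a *: g).
have S1mod : submodule S1.
  split=> [|a x y [c Sx] [d Sy]]; first by exists 0; rewrite scale0r subr0; case: Smod.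
  exists (a * c + d); have [_ /(_ a _ _ Sx Sy)] := Smod; congr S.
  by rewrite scalerBr scalerDl scalerA opprD addrACA.
have SS1 x : S x -> S1 x by exists 0; rewrite scale0r subr0.
have [full|/existsNP[v1 Sv1]] := pselect (forall x, S1 x).
  exists S, g; split=> // Sg; apply: Sv0; have [a Sa] := full v0.
  by rewrite -[v0](subrK (a *: g)); apply: submoduleD => //; exact: submoduleZ.
have [|T [v [Tmod S1T Tv Tcyc]]] := IH S1 v1 S1mod Sv1.
  move=> x; have [y /= [c hy] Sxy] := hl x; exists (y - c *: g) => //.
  by exists c; rewrite opprB addrA addrAC addrK.
by exists T, v; split=> // x /SS1/S1T.
Qed.

(* Substitute for the Auslander-Bridger formula. If G1* is not generated by the
   image of G0*, a cyclic quotient of the cokernel gives a map from G1* to R/(s)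
   for a maximal regular sequence s. It lifts to evaluation at some g in G1,
   and g lies in (s)G0, hence in (s)G1 as s is regular on D: a contradiction. *)
Lemma gproj_extends G1 G0 D (i : {linear G1 -> G0}) (p : {linear G0 -> D}) :
  ses i p -> gproj G1 -> gproj G0 -> deep D -> extends R^o i.
Proof.
move=> ip [fg1 inj1 surj1 _ a1] [fg0 inj0 surj0 _ a0] deepD f0.
pose S (f : dual_module G1) := exists g : {linear G0 -> R^o},
  forall a, g (i a) = (f : {linear G1 -> R^o}) a.
have Smod : submodule S.
  split=> [|c f f' [g gE] [g' gE']]; first by exists (lzero G0 R^o).
  by exists ((c \*: g) \+ g') => a /=; rewrite gE gE'.
apply: contrapT => Sf0.
have [T [f1 [Tmod ST Tf1 Tcyc]]] := cyclic_quotient_exists (fg_dual fg1) Smod Sf0.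
(* The annihilator of the class of [f1], so that the cyclic quotient by T is R/m. *)
pose m (a : R^o) := T ((a : R) *: f1).
have mmod : submodule m.
  split=> [|a b c mb mc]; first by rewrite /m scale0r; case: Tmod.
  by rewrite /m scalerDl -scalerA; apply: submoduleD => //; exact: submoduleZ.
have m1 : ~ m 1 by rewrite /m scale1r.
have [s [y [regs nsy smy]]] :=
  regular_sequence_exists (noetherian_regular noethR) mmod m1.
have [Q [q [qs qker]]] := quotient_exists (in_mul_submodule R^o s).
have [c cP] := choice Tcyc.
have qm a : m a -> q (a * y) = 0 by move=> ma; apply/qker; exact: smy.
have qE f a : T (f - a *: f1) -> q (c f * y) = q (a * y).
  move=> Ta; apply/eqP; rewrite -subr_eq0 -linearB -mulrBl; apply/eqP/qm.
  rewrite /m scalerBl; have := submoduleB Tmod Ta (cP f); congr T.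
  by rewrite opprB addrC addrA subrK.
(* The composite of the projection onto R/m with multiplication by y into R/(s), which is well
   defined because my lies in (s). *)
have uL : linear (fun f : dual_module G1 => q (c f * y)).
  move=> a f g; rewrite (@qE _ (a * c f + c g)).
    by rewrite mulrDl -mulrA -[a * _]/(a *: (c f * y : R^o)) linearP.
  have [_ /(_ a _ _ (cP f) (cP g))] := Tmod; congr T.
  by rewrite scalerBr scalerDl scalerA opprD addrACA.
pose u := mklin uL.
have u0 f : T f -> u f = 0.
  by move=> Tf; rewrite /u /= (@qE _ 0) ?mul0r ?linear0 // scale0r subr0.
have uf1 : u f1 = q y.
  rewrite /u /= (@qE _ 1) ?mul1r // scale1r subrr; by case: Tmod.
have [_ /(_ u)[e eE]] := acyclic_regular_lift a1 regs qs qker.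
have [g1 g1E] := surj1 e.
have evg1 (f : dual_module G1) : (f : {linear G1 -> R^o}) g1 = e f by rewrite -g1E.
(* A functional on G0 restricts to an element of S, where [u] vanishes, so its value at i(g1) is in
   (s); the biduality of G0 then applies. *)
have sg0 : in_mul s (i g1).
  apply: (in_mul_inj inj0 surj0); apply: in_mul_Hom => // f.
  apply/qker; rewrite -[LHS]/(q ((f : {linear G0 -> R^o}) (i g1))).
  pose fi : dual_module G1 := (f : {linear G0 -> R^o}) \o i.
  rewrite -[(f : {linear _ -> _}) _]/((fi : {linear G1 -> R^o}) g1) evg1 eE u0 //.
  by apply: ST; exists f.
have sg1 := in_mul_kernel ip (deepD _ regs) sg0.
have /qker := in_mul_lin (f1 : {linear G1 -> R^o}) sg1.
by rewrite evg1 eE uf1 => /qker.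
Qed.

Lemma dual_ses A B C (i : {linear A -> B}) (p : {linear B -> C}) :
  ses i p -> extends R^o i -> ses (precomp R^o p) (precomp R^o i).
Proof.
move=> ip ext; have [i_inj ps ker] := ip; split.
- apply: inj_lin => f f0; apply: Hom_ext => c; have [b <-] := ps c.
  exact: (congr1 (fun h : dual_module B => (h : {linear _ -> _}) b) f0).
- move=> f; have [g gE] := ext f; exists g; exact: Hom_ext.
- move=> f; split=> [f0|[g <-]].
    have [|g gE] := @descend _ _ _ _ p (f : {linear B -> R^o}) ps.
      move=> b /ker[a <-].
      exact: (congr1 (fun h : dual_module A => (h : {linear _ -> _}) a) f0).
    by exists g; apply: Hom_ext.
  by apply: Hom_ext => a /=; rewrite (ses_comp0 ip) linear0.
Qed.

(** A functional on the dual of C extends to the dual of B, where it is evaluation at some b; hence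
    it is evaluation at p(b). *)
Lemma biduality_surj_cokernel A B C (i : {linear A -> B}) (p : {linear B -> C}) :
  ses i p -> extends R^o i -> ext_acyclic (dual_module A) R^o ->
  surjective (@biduality R B) -> surjective (@biduality R C).
Proof.
move=> ip ext aA surjB t; have dip := dual_ses ip ext.
have [t' t'E] := acyclic_extends aA dip (t : {linear dual_module C -> R^o}).
have [b bE] := surjB t'; exists (p b); apply: Hom_ext => f.
by rewrite -[RHS]t'E -bE.
Qed.

(** If every functional kills p(b), evaluation at b factors through the dual of A, where it is
    evaluation at some a; injectivity for B gives b = i(a). *)
Lemma biduality_inj_cokernel A B C (i : {linear A -> B}) (p : {linear B -> C}) :
  ses i p -> extends R^o i -> surjective (@biduality R A) ->
  injective (@biduality R B) -> injective (@biduality R C).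
Proof.
move=> ip ext surjA injB; apply: inj_lin => c c0.
have [_ ps _] := ip; have [b bE] := ps c; rewrite -bE.
have [_ dis dker] := dual_ses ip ext.
have [|t tE] := @descend _ _ _ _ (precomp R^o i)
  (@biduality R B b : {linear dual_module B -> R^o}) dis.
  move=> f /dker[g <-].
  have := congr1 (fun h : dual_module (dual_module C) =>
    (h : {linear dual_module C -> R^o}) g) c0.
  by rewrite -bE.
have [a aE] := surjA t; have -> : b = i a.
  by apply: injB; apply: Hom_ext => f; rewrite -[LHS]tE -aE.
exact: ses_comp0 ip a.
Qed.

Lemma gproj_cokernel G1 G0 D (i : {linear G1 -> G0}) (p : {linear G0 -> D}) :
  ses i p -> gproj G1 -> gproj G0 -> extends R^o i -> gproj D.
Proof.
move=> ip [fg1 inj1 surj1 a1 a1'] [fg0 inj0 surj0 a0 a0'] ext; split.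
- by apply: (fg_surj (f := p)) fg0; case: ip.
- exact: biduality_inj_cokernel ip ext surj1 inj0.
- exact: biduality_surj_cokernel ip ext a1' surj0.
- exact: acyclic_cokernel ip ext a1 a0.
- exact: acyclic_kernel (dual_ses ip ext) a0' a1'.
Qed.

(* n counts the terms of the resolution, so that only 0 is resolved in 0 steps. *)
Fixpoint resolved_by (C : lmodType R -> Prop) (n : nat) (D : lmodType R) : Prop :=
  if n is n'.+1 then
    exists K G (i : {linear K -> G}) (p : {linear G -> D}),
      [/\ ses i p, C G & resolved_by C n' K]
  else zero_module D.

Lemma finite_resolution_resolved (C : lmodType R -> Prop) D m :
  has_finite_resolution C D m -> resolved_by C m.+1 D.
Proof.
move=> [X [XC X0]].
(* Induction on the tail starting at degree n. The k + 1 terms are X_n, ..., X_m; after the last one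
   the kernel is the image of X_(m+1), which is zero. *)
suff step k n B (q : {linear X n -> B}) : surjective q ->
    (forall x, q x = 0 <-> exists y, cplx_diff X n y = x) ->
    (n + k = m)%N -> resolved_by C k.+1 B.
  exact: step _ 0%N _ (res_aug X) (@res_aug_surj _ _ X) (@res_exact0 _ _ X) (add0n m).
elim: k n B q => [|k IH] n B q qs qker nk.
  exists (ker_module q), (X n), (ker_incl q), q; split; first exact: ker_ses.
    by apply: XC; rewrite -nk leq_addr.
  move=> x; have kq := ker_ses qs; case: (kq) => kinj _ _; apply: kinj.
  have /qker[y <-] := ses_comp0 kq x; rewrite (X0 n.+1 _ y) ?linear0 //.
  by rewrite -nk addn0.
exists (ker_module q), (X n), (ker_incl q), q; split; first exact: ker_ses.
  by apply: XC; rewrite -nk leq_addr.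
have [kinj _ kker] := ker_ses qs.
have [|d dE] := @corestrict _ _ _ _ (ker_incl q) (cplx_diff X n) kinj.
  by move=> y; apply/kker/qker; exists y.
apply: (IH n.+1 _ d); last by rewrite addSnnS.
- move=> x; have /qker[y yE] := ses_comp0 (ker_ses qs) x.
  by exists y; apply: kinj; rewrite dE.
- move=> x; split=> [dx|/(res_exactS (r := X)) dx].
    by apply/(res_exactS (r := X)); rewrite -dE dx linear0.
  by apply: kinj; rewrite dE linear0.
Qed.

Lemma inf_nat_finite (F : nat -> Prop) : (inf_nat F < +oo)%E -> exists n, F n.
Proof.
rewrite /inf_nat; case: pselect => [[n /asboolP Fn] _|_ //]; by exists n.
Qed.

Lemma zero_dual_basis V : zero_module V -> dual_basis V.
Proof.
move=> V0; exists 0%N, (fun=> 0), (fun=> lzero V R^o) => x.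
by rewrite big_ord0.
Qed.

(** The kernel K is again deep, so induction applies to it; [gproj_extends] then kills the one
    remaining obstruction, Ext^1(D, R). *)
Lemma resolved_gproj n D : resolved_by gproj n D -> deep D -> gproj D.
Proof.
elim: n D => [|n IH] D; first by move=> /zero_dual_basis/dual_basis_gproj.
move=> [K [G [i [p [ip gG rK]]]]] deepD.
have gK := IH K rK (deep_kernel ip (gproj_deep gG) deepD).
exact: gproj_cokernel ip gK gG (gproj_extends ip gK gG deepD).
Qed.
End TotallyReflexive.
(** * Finite projective dimension *)

Section FiniteProjectiveDimension.
Context {R : comPzRingType}.
Hypothesis noethR : noetherian R.
Implicit Types U V W A B C D E G K N P Q X Y M : lmodType R.

(** Here level 0 is projectivity rather than vanishing, so n bounds the projective dimension. *)
Fixpoint pd_le (n : nat) (A : lmodType R) : Prop :=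
  if n is n'.+1 then
    exists K P (i : {linear K -> P}) (p : {linear P -> A}),
      [/\ ses i p, projective_module P & pd_le n' K]
  else projective_module A.

Lemma resolved_pd_le n A : resolved_by (@projective_module R) n A -> pd_le n A.
Proof.
elim: n A => [|n IH] A; first exact: zero_projective.
by move=> [K [P [i [p [ip hP /IH rK]]]]]; exists K, P, i, p.
Qed.

(** The sequence splits, so adding P to a cover of A gives a cover of W with the same kernel. *)
Lemma pd_le_extension n A W P (i : {linear A -> W}) (p : {linear W -> P}) :
  ses i p -> projective_module P -> pd_le n A -> pd_le n W.
Proof.
case: n => [|n] ip hP; first by move=> hA; exact: extension_projective ip hA hP.
move=> [K [P1 [j [q [jq hP1 hK]]]]]; have [s [r ps [ri rs rsE]]] := ses_split ip hP.
exists K, (P1 * P)%type, (pairl P1 P \o j : {linear _ -> _}).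
exists ((i \o q \o fst) \+ (s \o snd) : {linear (P1 * P)%type -> W}).
split=> //; last exact: prod_projective.
have [j_inj qs jker] := jq; have [i_inj _ _] := ip; split.
- by move=> x y [/j_inj].
- move=> w; have [u uE] := qs (r w); exists (u, p w); by rewrite /= uE rsE.
- move=> [u v] /=; split=> [e|[k [<- <-]]]; last first.
    by rewrite (ses_comp0 jq) !linear0 addr0.
  have v0 : v = 0.
    by rewrite -(ps v) -[s v](addKr (i (q u))) e addr0 linearN (ses_comp0 ip) oppr0.
  have /jker[k kE] : q u = 0.
    by apply: i_inj; move: e; rewrite v0 linear0 addr0 => ->; rewrite linear0.
  by exists k; rewrite kE v0.
Qed.

Lemma pd_le_split_kernel n X W Y (i : {linear X -> W}) (p : {linear W -> Y}) :
  ses i p -> projective_module Y -> pd_le n W -> pd_le n X.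
Proof.
case: n => [|n] ip hY.
  by have [s [r ps [ri rs rsE]]] := ses_split ip hY; apply: (retract_projective ri).
move=> [W' [P [j [q [jq hP hW']]]]].
have [X' [c [d [k [t [cd kt _ _]]]]]] := split_kernel_cover ip hY jq.
by exists X', P, c, d; split=> //; exact: pd_le_extension kt hY hW'.
Qed.

(** A form of Auslander-Buchsbaum. The syzygy in a finite free cover is deep of smaller projective
    dimension, hence projective by induction; [gproj_extends] extends its functionals to the cover,
    which splits the cover. *)
Lemma deep_pd_le_projective n E :
  fg_module E -> deep E -> pd_le n E -> projective_module E.
Proof.
elim: n E => [//|n IH] E fgE deepE [K [P [i [p [ip hP hK]]]]].
have [m [p0 p0s]] := fg_free_cover fgE; set F := 'rV[R]_m in p0 p0s.
have dF : dual_basis F := rV_dual_basis m.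
have gF := dual_basis_gproj dF; have hF := dual_basis_projective dF.
have ip0 := ker_ses p0s; set i0 := ker_incl p0 in ip0; have [i0_inj _ _] := ip0.
have fgK0 : fg_module (ker_module p0).
  by apply: (fg_injective noethR i0_inj); case: gF.
have hK0 : pd_le n (ker_module p0).
  (* Schanuel's argument: the pullback is an extension of F by K and of P by the kernel of [p0]. *)
  have [W [w1 [w2 pb]]] := pullback_exists p0 p.
  have [j jw _] := pullback_ses pb ip0.
  have [k kw _] := pullback_ses (pullbackC pb) ip.
  exact: pd_le_split_kernel jw hP (pd_le_extension kw hF hK).
have prK0 := IH _ fgK0 (deep_kernel ip0 (gproj_deep gF) deepE) hK0.
have dK0 := projective_dual_basis fgK0 prK0.
have ext := gproj_extends noethR ip0 (dual_basis_gproj dK0) gF deepE.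
have [l [e [g eg]]] := dK0; have [g' g'E] := choice (fun x => ext (g x)).
(* Extending the coordinate functionals of the syzygy to F turns its dual basis into a
   retraction. *)
have rL : linear (fun u : F => \sum_x (g' x u : R) *: e x).
  move=> a u v; rewrite scaler_sumr -big_split; apply: eq_bigr => x _ /=.
  by rewrite linearP scalerDl scalerA.
pose r := mklin rL.
have ri0 x : r (i0 x) = x.
  by rewrite [RHS]eg; apply: eq_bigr => y _; rewrite g'E.
have [|s sE] := @descend _ _ _ _ p0 (idfun \- (i0 \o r) : {linear F -> F}) p0s.
  move=> u; case: ip0 => _ _ ker /ker[x <-].
  by rewrite -[LHS]/(i0 x - i0 (r (i0 x))) ri0 subrr.
apply: (@retract_projective _ _ _ s p0) hF => x; have [u <-] := p0s x.
by rewrite sE linearB /= (ses_comp0 ip0) subr0.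
Qed.
End FiniteProjectiveDimension.

(** * Reflexivity and the trace ideal *)

Section Main.
Context {R : comPzRingType}.
Hypothesis noethR : noetherian R.
Implicit Types V W A B C D E G K N P Q M : lmodType R.

(** Surjectivity for M comes from acyclicity of the dual of its syzygy, and injectivity from
    surjectivity for the syzygy. So [surj_syz] also hands the hypotheses down, and is applied
    twice. *)
Lemma dual_gproj_reflexive M : fg_module M -> ext_acyclic M R^o ->
  gproj (dual_module M) ->
  injective (@biduality R M) /\ surjective (@biduality R M).
Proof.
have surj_syz N : fg_module N -> ext_acyclic N R^o -> gproj (dual_module N) ->
    surjective (@biduality R N) /\
    exists (N1 F : lmodType R) (i : {linear N1 -> F}) (p : {linear F -> N}),
      [/\ ses i p, dual_basis F & [/\ fg_module N1, ext_acyclic N1 R^o,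
      extends R^o i & gproj (dual_module N1)]].
  move=> fgN aN gN; have [n [p ps]] := fg_free_cover fgN.
  set F := 'rV[R]_n in p ps; have dF : dual_basis F := rV_dual_basis n.
  have ip := ker_ses ps; set i := ker_incl p in ip; have [i_inj _ _] := ip.
  have ext := acyclic_extends aN ip.
  have [fgF injF surjF aF _] := dual_basis_gproj dF.
  have aN1 := acyclic_kernel ip aF aN; have dip := dual_ses ip ext.
  have gF' := dual_basis_gproj (dual_basis_dual dF).
  (* The dual of N1 is deep, so the dual sequence makes it [gproj]. *)
  have ext' := gproj_extends noethR dip gN gF' (deep_Hom aN1 (@deep_regular R)).
  have gN1 := gproj_cokernel dip gN gF' ext'.
  split; last first.
    exists _, F, i, p; split=> //; split=> //; exact: (fg_injective noethR i_inj fgF).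
  by apply: biduality_surj_cokernel ip ext _ surjF; case: gN1.
move=> fgM aM gM.
have [surjM [M1 [F [i [p [ip dF [fgM1 aM1 ext gM1]]]]]]] := surj_syz M fgM aM gM.
have [surjM1 _] := surj_syz M1 fgM1 aM1 gM1; split=> //.
exact: biduality_inj_cokernel ip ext surjM1 (dual_basis_biduality_inj dF).
Qed.

(** * The trace ideal and projectivity of M *)

Section TraceIdeal.
Variable M : lmodType R.

(* The sum of the trace ideal and of the annihilator of M. *)
Definition acts_as_trace (a : R^o) : Prop :=
  exists r : seq ({linear M -> R^o} * M),
    forall v : M, (a : R) *: v = \sum_(t <- r) (t.1 t.2 : R) *: v.

Lemma acts_as_trace_submodule : submodule acts_as_trace.
Proof.
split=> [|a b c [r rP] [r' r'P]].
  by exists [::] => v; rewrite big_nil scale0r.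
exists ([seq (t.1, a *: t.2) | t <- r] ++ r') => v.
rewrite big_cat big_map /= scalerDl -scalerA rP r'P scaler_sumr; congr (_ + _).
by apply: eq_bigr => t _; rewrite scalerA [t.1 (_ *: _)]linearZ.
Qed.

Fact rank_one_fun_linear (l : {linear M -> R^o}) (v : M) :
  linear (fun x => (l x : R) *: v).
Proof. by move=> c x y; rewrite linearP scalerDl scalerA. Qed.

Fact rank_one_linear (l : {linear M -> R^o}) :
  linear (fun v => mklin (rank_one_fun_linear l v) : Hom_module M M).
Proof.
by move=> c v w; apply: Hom_ext => x; rewrite /= scalerDr !scalerA mulrC.
Qed.

Definition rank_one l : {linear M -> Hom_module M M} := mklin (rank_one_linear l).

(** The maps [rank_one t.1] embed M into a power of E, and evaluation at the [t.2] retracts.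
    Expanding [rank_one t.1 v] in the dual basis of E writes v through finitely many elements of M,
    whose images lift one at a time. *)
Lemma trace_projective : acts_as_trace 1 -> dual_basis (Hom_module M M) ->
  projective_module M.
Proof.
move=> [r rP] [n [e [g eg]]] A B p f ps.
have [a aE] := choice (fun w => ps (f w)).
have [G GE] : exists G : {linear M -> R^o} -> 'I_n -> {linear M -> R^o},
    forall l i v, G l i v = g i (rank_one l v).
  by exists (fun l i => g i \o rank_one l : {linear M -> R^o}).
pose h v := \sum_(t <- r) \sum_i (G t.1 i v : R) *: a ((e i : {linear M -> M}) t.2).
have hL : linear h.
  move=> c v w; rewrite /h scaler_sumr -big_split; apply: eq_bigr => t _ /=.
  rewrite scaler_sumr -big_split; apply: eq_bigr => i _ /=.
  by rewrite linearP scalerDl scalerA.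
exists (mklin hL) => v; rewrite /= /h -[v in RHS]scale1r rP !linear_sum.
apply: eq_bigr => t _; rewrite linear_sum.
rewrite -[(t.1 t.2 : R) *: v]/(eval M t.2 (rank_one t.1 v)).
rewrite [in RHS](eg (rank_one t.1 v)) !linear_sum; apply: eq_bigr => i _.
by rewrite GE !linearZ aE.
Qed.

Lemma trace_ideal_full : fg_module M -> ext_acyclic M M ->
  ext_acyclic (dual_module M) R^o ->
  injective (@biduality R M) -> surjective (@biduality R M) ->
  dual_basis (Hom_module M M) -> acts_as_trace 1.
Proof.
move=> fgM aM aD inj surj [n [e [g eg]]]; apply: contrapT => T1.
have [s [y [regs nsy sTy]]] :=
  regular_sequence_exists (noetherian_regular noethR) acts_as_trace_submodule T1.
have regM : regular_on M s.
  by apply: (regular_iso inj surj); apply: regular_Hom.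
(* Since f(yv) = f(v)y and f(v) is in the trace ideal, f(yv) lies in (s). *)
have syM (v : M) : in_mul s ((y : R) *: v).
  apply: (in_mul_inj inj surj); apply: in_mul_Hom => // f.
  pose f' : {linear M -> R^o} := f; rewrite -[X in in_mul _ X]/(f' ((y : R) *: v)).
  rewrite linearZ /= [_ *: _]mulrC; apply: sTy.
  by exists [:: (f', v)] => w; rewrite big_seq1.
pose idM : Hom_module M M := (idfun : {linear M -> M}).
have syid : in_mul s ((y : R) *: idM) by apply: in_mul_Hom.
pose b (a : R^o) := in_mul s (a * y : R^o).
have smod := in_mul_submodule R^o s.
have bmod : submodule b.
  split=> [|a c d bc bd]; first by rewrite /b mul0r; case: smod.
  by rewrite /b mulrDl -mulrA; case: smod => _; exact.
(* Expanding the identity in the dual basis gives v as the sum of g_i(id) e_i(v), and g_i(id) is in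
   ((s) : y) because g_i sends y id into (s). *)
have [v|z bz zM] := nakayama bmod fgM.
  exists n, (fun i => g i idM), (fun i => (e i : {linear M -> M}) v); split.
    by move=> i; rewrite /b mulrC; have := in_mul_lin (g i) syid; rewrite linearZ.
  rewrite -[LHS]/(eval M v idM) [in LHS](eg idM) linear_sum.
  by apply: eq_bigr => i _; rewrite linearZ.
(* Here z annihilates M, so it acts as the empty trace sum and zy is in (s), while 1 - z is in ((s)
   : y). *)
apply: nsy; have -> : y = (1 - z) * y + z * y by rewrite -mulrDl subrK mul1r.
apply: (submoduleD smod bz); apply: sTy.
by exists [::] => v; rewrite big_nil zM.
Qed.
End TraceIdeal.
End Main.

Theorem corollary5p12 (R : comPzRingType) (M : lmodType R)
    (R_noetherian : noetherian R) (M_fg : finitely_generated M)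
    (G_dim_fin : (G_dim (dual_module M) < +oo)%E)
    (pd_fin : (proj_dim (Hom_module M M) < +oo)%E)
    (ExtMR : forall i, (0 < i)%N -> zero_module (Ext i M R^o))
    (ExtMM : forall i, (0 < i)%N -> zero_module (Ext i M M)) :
  projective_module M.
Proof.
have fgM := finitely_generated_fg M_fg.
have aMR := Ext_acyclic ExtMR; have aMM := Ext_acyclic ExtMM.
have gD : gproj (dual_module M).
  have [m /finite_resolution_resolved resD] := inf_nat_finite G_dim_fin.
  apply: (@resolved_gproj _ R_noetherian m.+1); last first.
    exact: deep_Hom aMR (@deep_regular R).
  elim: m.+1 (dual_module M) resD => // n IH D [K [G [i [p [ip tG /IH rK]]]]].
  by exists K, G, i, p; split=> //; exact: totally_reflexive_gproj.
have [inj surj] := dual_gproj_reflexive R_noetherian fgM aMR gD.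
have aD : ext_acyclic (dual_module M) R^o by case: gD.
have deepM : deep M.
  exact: deep_iso inj surj (deep_Hom aD (@deep_regular R)).
have [m /finite_resolution_resolved/resolved_pd_le pdE] := inf_nat_finite pd_fin.
have fgE := fg_Hom R_noetherian fgM fgM.
have prE := deep_pd_le_projective R_noetherian fgE (deep_Hom aMM deepM) pdE.
have dE := projective_dual_basis fgE prE.
exact: trace_projective (trace_ideal_full R_noetherian fgM aMM aD inj surj dE) dE.
Qed.
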